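(* Let $(X,d,\nu)$ be a computable metric space and $N\in\mathbb{N}$. Define the following multi-valued operations, each with domain the set of all (finite, respectively infinite) sequences $(U_i)_i$ of open sets with $\bigcup_iU_i=X$: $C^{\sigma}:\subseteq\Sigma^0_1(X)^{\sigma}\rightrightarrows\Sigma^0_1(X)^{\sigma}$ for $\sigma\in\{*,\omega\}$: $C^{\sigma}((U_i)_i)=\{(W_i)_i : (W_i)_i\text{ is a shrinking of }(U_i)_i\text{ of order}\leq N+1\}$; $\dot{C}^{*}:\subseteq\Sigma^0_1(X)^{*}\rightrightarrows\Sigma^0_1(X)^{*}\times\mathbb{N}^{*}$: $\dot{C}^{*}((U_i)_{i<k})=\{((W_j)_{j<l},r) : |r|=l,\ (\forall j<l)\,W_j\subseteq U_{r_j},\ (W_j)_j\text{ is a cover of }X\text{ of order}\leq N+1\}$; $\dot{C}^{\omega}:\subseteq\Sigma^0_1(X)^{\mathbb{N}}\rightrightarrows\Sigma^0_1(X)^{\mathbb{N}}\times\mathbb{N}^{\mathbb{N}}$: $\dot{C}^{\omega}((U_i)_{i\in\mathbb{N}})=\{((W_j)_{j\in\mathbb{N}},r) : (\forall j)\,W_j\subseteq U_{r_j},\ (W_j)_j\text{ is a cover of }X\text{ of order}\leq N+1\}$; $\overline{C}:\subseteq\Sigma^0_1(X)^{*}\rightrightarrows\Pi^0_1(X)^{*}$: $\overline{C}((U_i)_{i<k})=\{(F_i)_{i<k} : (F_i)_i\text{ is a shrinking of }(U_i)_i\text{ of order}\leq N+1\}$; $\dot{\overline{C}}:\subseteq\Sigma^0_1(X)^{*}\rightrightarrows\Pi^0_1(X)^{*}\times\mathbb{N}^{*}$: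 $\dot{\overline{C}}((U_i)_{i<k})=\{((F_j)_{j<l},r) : |r|=l,\ (\forall j<l)\,F_j\subseteq U_{r_j},\ (F_j)_j\text{ is a cover of }X\text{ of order}\leq N+1\}$. Consider the conditions: (1) $C^{\omega}$ is $(\delta_{\Sigma^0_1}^{\omega},\delta_{\Sigma^0_1}^{\omega})$-computable; (2) $\dot{C}^{\omega}$ is $(\delta_{\Sigma^0_1}^{\omega},[\delta_{\Sigma^0_1}^{\omega},\mathrm{id}_{\mathbb{B}}])$-computable; (3) $C^{*}$ is $(\delta_{\Sigma^0_1}^{*},\delta_{\Sigma^0_1}^{*})$-computable; (4) $\dot{C}^{*}$ is $(\delta_{\Sigma^0_1}^{*},[\delta_{\Sigma^0_1}^{*},\delta_{\mathbb{N}^{*}}])$-computable; (5) $\overline{C}$ is $(\delta_{\Sigma^0_1}^{*},\delta_{\Pi^0_1}^{*})$-computable; (6) $\dot{\overline{C}}$ is $(\delta_{\Sigma^0_1}^{*},[\delta_{\Pi^0_1}^{*},\delta_{\mathbb{N}^{*}}])$-computable. Then (3), (4), (5) and (6) are equivalent. Also (1)$\iff$(2)$\implies$(3).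
   Context: TTE conventions. $\mathbb{B}=\mathbb{N}^{\mathbb{N}}$, $p_i:=p(i)$. $\langle\cdot\rangle:\mathbb{N}^*\to\mathbb{N}$ and $\langle\cdot,\cdot\rangle:\mathbb{N}^2\to\mathbb{N}$ are standard computable tupling bijections. On $\mathbb{B}$: $\langle p^{(0)},p^{(1)}\rangle(2i+z)=p^{(z)}_i$ ($z\in\{0,1\}$) and $\langle p^{(0)},p^{(1)},\dots\rangle(\langle i,j\rangle)=p^{(i)}_j$. A representation of a set is a partial surjection $\delta:\subseteq\mathbb{B}\to X$. A multi-valued operation $f:\subseteq X\rightrightarrows Y$ assigns to each $x\in\operatorname{dom}f$ a subset $f(x)\subseteq Y$; for representations $\delta,\delta'$ of $X,Y$ it is $(\delta,\delta')$-computable if there is a (Type-2 Turing machine) computable $F:\subseteq\mathbb{B}\to\mathbb{B}$ such that whenever $p\in\operatorname{dom}\delta$ and $\delta(p)\in\operatorname{dom}f$, $F(p)$ is defined, $F(p)\in\operatorname{dom}\delta'$ and $\delta'(F(p))\in f(\delta(p))$. Also $[\delta_1,\delta_2]\langle p,q\rangle=(\delta_1(p),\delta_2(q))$; $\delta^{\omega}\langle p^{(0)},p^{(1)},\dots\rangle=(\delta(p^{(i)}))_i$; $\delta^{*}(n.\langle p^{(0)},p^{(1)},\dots\rangle)=\delta(p^{(0)})\dots\delta(p^{(n-1)})\in X^*$ (empty word if $n=0$), where $n.q$ is $q$ prefixed by $n$; $\delta_{\mathbb{N}^{*}}(p)=w$ where $p_0=\langle w\rangle$. $\Sigma^0_1(X)^{\omega}$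 means $\Sigma^0_1(X)^{\mathbb{N}}$. Computable metric space $(X,d,\nu)$: $(X,d)$ is a metric space, $\nu:\mathbb{N}\to X$ is total with dense image, and $(i,j)\mapsto d(\nu(i),\nu(j))$ is a computable double sequence of reals. With $\nu_{\mathbb{Q}^+}$ a standard total numbering of the positive rationals, $\alpha\langle a,r\rangle=B_d(\nu(a);\nu_{\mathbb{Q}^+}(r))$. $\Sigma^0_1(X)$ (open sets) carries $\delta_{\Sigma^0_1}(p)=\bigcup\{\alpha(p_i-1) : p_i\geq1\}$; $\Pi^0_1(X)$ (closed sets) carries $\delta_{\Pi^0_1}(p)=X\setminus\delta_{\Sigma^0_1}(p)$. A shrinking of a cover $(A_i)_{i\in I}$ of $X$ is a cover $(B_i)_{i\in I}$ of $X$ with $B_i\subseteq A_i$ for all $i$. The order of a family $(A_i)_{i\in I}$ is the least $n$ such that $\bigcap_{j\leq n}A_{i_j}=\emptyset$ whenever $i_0,\dots,i_n$ are distinct elements of $I$ (so order $\leq N+1$ means any $N+2$ members with distinct indices have empty intersection). *)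

(* Defs.v *)
From Stdlib Require Cantor.
From mathcomp Require Import all_boot all_order all_algebra.
From mathcomp Require Import all_classical reals topology.

Set Implicit Arguments.
Unset Strict Implicit.
Unset Printing Implicit Defensive.
Import Order.TTheory GRing.Theory Num.Theory.

Local Open Scope classical_set_scope.
Local Open Scope ring_scope.

Definition baire := nat -> nat.

Inductive move := Left | Stay | Right.

(* [None] is the blank symbol.  A tape is the pair of the cells to the left
   of the head (nearest first) and the cells from the head on; cells beyond
   either list are blank. *)
Definition tape (S : Type) : Type := seq (option S) * seq (option S).

Definition tape_read (S : Type) (t : tape S) : option S := head None t.2.

Definition tape_write (S : Type) (a : option S) (t : tape S) : tape S :=
  (t.1, a :: behead t.2).

Definition tape_move (S : Type) (m : move) (t : tape S) : tape S :=
  match m with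
  | Left => (behead t.1, head None t.1 :: t.2)
  | Stay => t
  | Right => (tape_read t :: t.1, behead t.2)
  end.

(* One one-way read-only input tape and one one-way write-only output tape,
   both over the alphabet [bool], and [ntapes] two-way work tapes.  According
   to its state, the scanned input symbol and the scanned work symbols, the
   machine changes state, possibly advances the input head by one cell, writes
   and moves on each work tape, and writes at most one output symbol. *)
Record type2_machine := Type2Machine {
  state : finType;
  init : state;
  symbol : finType;
  ntapes : nat;
  next_state : state -> bool -> {ffun 'I_ntapes -> option symbol} -> state;
  advance : state -> bool -> {ffun 'I_ntapes -> option symbol} -> bool;
  work : state -> bool -> {ffun 'I_ntapes -> option symbol} ->
    'I_ntapes -> option symbol * move;
  emit : state -> bool -> {ffun 'I_ntapes -> option symbol} -> option bool
}.

Record config (M : type2_machine) := Config {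
  cstate : state M;
  cpos : nat;
  ctapes : 'I_(ntapes M) -> tape (symbol M);
  coutput : seq bool
}.

Definition initial (M : type2_machine) : config M :=
  Config (init M) 0 (fun=> ([::], [::])) [::].

Definition step (M : type2_machine) (input : nat -> bool) (c : config M) :
    config M :=
  let s := cstate c in
  let b := input (cpos c) in
  let a := [ffun k => tape_read (ctapes c k)] in
  Config (next_state s b a)
    (cpos c + advance s b a)%N
    (fun k => tape_move (work s b a k).2
                (tape_write (work s b a k).1 (ctapes c k)))
    (coutput c ++ seq_of_opt (emit s b a)).

Definition run (M : type2_machine) (input : nat -> bool) (t : nat) : config M :=
  iter t (step input) (initial M).

(* Elements of Baire space are written on the tapes as
   1^(p 0) 0 1^(p 1) 0 1^(p 2) 0 ... *)
Definition unary_prefix (p : baire) (n : nat) : seq bool :=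
  flatten [seq rcons (nseq (p i) true) false | i <- iota 0 n].

Definition unary (p : baire) : nat -> bool :=
  fun n => nth false (unary_prefix p n.+1) n.

(* The graph of the partial function on Baire space computed by [M]. *)
Definition machine_function (M : type2_machine) (p q : baire) : Prop :=
  forall n, exists t, prefix (unary_prefix q n) (coutput (run M (unary p) t)).

(* A partial function is given by its graph. *)
Definition computable_fun (F : baire -> baire -> Prop) : Prop :=
  exists M : type2_machine, forall p q, F p q <-> machine_function M p q.

(* [q] is computable iff the constant function with value [q] is. *)
Definition computable_seq (q : baire) : Prop :=
  computable_fun (fun _ q' => q' = q).

Definition npair (i j : nat) : nat := Cantor.to_nat (i, j).

Definition ncode : seq nat -> nat := CodeSeq.code.

Definition even_part (p : baire) : baire := fun i => p i.*2.
Definition odd_part (p : baire) : baire := fun i => p i.*2.+1.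
Definition component (p : baire) (i : nat) : baire := fun j => p (npair i j).
Definition tail (p : baire) : baire := fun i => p i.+1.

Record representation (X : Type) := Representation {
  names : baire -> X -> Prop;
  names_fun : forall p x y, names p x -> names p y -> x = y;
  names_onto : forall x, exists p, names p x
}.

Record multifun (X Y : Type) := Multifun {
  mdom : set X;
  mval : X -> set Y
}.

Definition computable_multifun (X Y : Type) (delta : representation X)
    (delta' : representation Y) (f : multifun X Y) : Prop :=
  exists2 F : baire -> baire -> Prop, computable_fun F &
    forall p x, names delta p x -> mdom f x ->
      exists q y, [/\ F p q, names delta' q y & mval f x y].

Definition id_names (p q : baire) : Prop := p = q.

Lemma id_names_fun p x y : id_names p x -> id_names p y -> x = y.
Proof. by move=> <-. Qed.

Lemma id_names_onto x : exists p, id_names p x.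
Proof. by exists x. Qed.

Definition delta_id : representation baire :=
  Representation id_names_fun id_names_onto.

Definition word_names (p : baire) (w : seq nat) : Prop := p 0%N = ncode w.

Lemma word_names_fun p x y : word_names p x -> word_names p y -> x = y.
Proof. by rewrite /word_names => -> /(can_inj CodeSeq.codeK). Qed.

Lemma word_names_onto x : exists p, word_names p x.
Proof. by exists (fun=> ncode x). Qed.

Definition delta_word : representation (seq nat) :=
  Representation word_names_fun word_names_onto.

Section combinators.
Variables (X Y : Type) (delta : representation X) (delta' : representation Y).

Definition prod_names (p : baire) (z : X * Y) : Prop :=
  names delta (even_part p) z.1 /\ names delta' (odd_part p) z.2.

Lemma prod_names_fun p x y : prod_names p x -> prod_names p y -> x = y.
Proof.
case: x y => [x x'] [y y'] [/= px px'] [/= py py'].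
by rewrite (names_fun px py) (names_fun px' py').
Qed.

Lemma prod_names_onto x : exists p, prod_names p x.
Proof.
case: x => x y.
have [p px] := names_onto delta x; have [q qy] := names_onto delta' y.
exists (fun i => if odd i then q i./2 else p i./2); split => /=.
  suff -> : even_part (fun i => if odd i then q i./2 else p i./2) = p by [].
  by apply/funext => i; rewrite /even_part odd_double doubleK.
suff -> : odd_part (fun i => if odd i then q i./2 else p i./2) = q by [].
by apply/funext => i; rewrite /odd_part /= odd_double /= uphalf_double.
Qed.

Definition delta_prod : representation (X * Y) :=
  Representation prod_names_fun prod_names_onto.

Definition omega_names (p : baire) (x : nat -> X) : Prop :=
  forall i, names delta (component p i) (x i).

Lemma omega_names_fun p x y : omega_names p x -> omega_names p y -> x = y.
Proof. by move=> px py; apply/funext => i; exact: names_fun (px i) (py i). Qed.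

Lemma component_tuple (f : nat -> baire) i :
  component (fun n => f (Cantor.of_nat n).1 (Cantor.of_nat n).2) i = f i.
Proof.
by apply/funext => j; rewrite /component /npair Cantor.cancel_of_to.
Qed.

Lemma omega_names_onto x : exists p, omega_names p x.
Proof.
have [f fx] := choice (fun i => names_onto delta (x i)).
exists (fun n => f (Cantor.of_nat n).1 (Cantor.of_nat n).2) => i.
by rewrite component_tuple.
Qed.

Definition delta_omega : representation (nat -> X) :=
  Representation omega_names_fun omega_names_onto.

Definition star_names (p : baire) (x : seq X) : Prop :=
  p 0%N = size x /\
  forall i : 'I_(size x),
    names delta (component (tail p) i) (tnth (in_tuple x) i).

Lemma star_names_fun p x y : star_names p x -> star_names p y -> x = y.
Proof.
case=> [p0x px] [p0y py].
have exy : size x = size y by rewrite -p0x.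
case: x y exy p0x px p0y py => [|x0 x] [|y0 y]// exy _ px _ py.
apply: (@eq_from_nth _ x0) => // i ix.
have iy : (i < size (y0 :: y))%N by rewrite -exy.
move: (px (Ordinal ix)) (py (Ordinal iy)).
by rewrite !(tnth_nth x0) => pxi pyi; exact: names_fun pxi pyi.
Qed.

Lemma star_names_onto x : exists p, star_names p x.
Proof.
case: x => [|x0 x]; first by exists (fun=> 0%N); split => // -[].
have [p px] := omega_names_onto (nth x0 (x0 :: x)).
exists (fun n => if n is n'.+1 then p n' else size (x0 :: x)); split => // i.
by rewrite (tnth_nth x0); exact: px.
Qed.

Definition delta_star : representation (seq X) :=
  Representation star_names_fun star_names_onto.

End combinators.

(* [<<i,j>,k>] numbers (i - j)/(k + 1). *)
Definition nu_rat (n : nat) : rat :=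
  let: (m, k) := Cantor.of_nat n in
  let: (i, j) := Cantor.of_nat m in
  (i%:R - j%:R) / k.+1%:R.

(* [<i,j>] numbers (i + 1)/(j + 1). *)
Definition nu_posrat (n : nat) : rat :=
  let: (i, j) := Cantor.of_nat n in i.+1%:R / j.+1%:R.

Definition computable_double_seq (R : realType) (x : nat -> nat -> R) : Prop :=
  exists2 g : baire, computable_seq g &
    forall i j k : nat,
      `|x i j - ratr (nu_rat (g (npair i (npair j k))))| <= 2^-1 ^+ k.

Record computable_metric_space (R : realType) := ComputableMetricSpace {
  space :> metricType R;
  nu : nat -> space;
  nu_dense : dense (range nu);
  nu_computable : computable_double_seq (fun i j => mdist (nu i) (nu j))
}.

Section hyperspaces.
Variables (R : realType) (X : computable_metric_space R).

Record Sigma01 := OpenSet {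
  open_set :> set X;
  open_set_open : open open_set
}.

Record Pi01 := ClosedSet {
  closed_set :> set X;
  closed_set_closed : closed closed_set
}.

Lemma Sigma01_eq (U V : Sigma01) : U = V :> set X -> U = V.
Proof.
by case: U V => [U oU] [V oV] /= UV; subst V; rewrite (Prop_irrelevance oU oV).
Qed.

Lemma Pi01_eq (F G : Pi01) : F = G :> set X -> F = G.
Proof.
by case: F G => [F cF] [G cG] /= FG; subst G; rewrite (Prop_irrelevance cF cG).
Qed.

Definition alpha (n : nat) : set X :=
  let: (a, r) := Cantor.of_nat n in
  [set x | mdist (nu X a) x < ratr (nu_posrat r)].

Definition enumerated (p : baire) : set X :=
  \bigcup_(i in [set i | (1 <= p i)%N]) alpha (p i).-1.

Definition Sigma01_names (p : baire) (U : Sigma01) : Prop :=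
  open_set U = enumerated p.

Definition Pi01_names (p : baire) (F : Pi01) : Prop :=
  closed_set F = ~` enumerated p.

Lemma Sigma01_names_fun p U V :
  Sigma01_names p U -> Sigma01_names p V -> U = V.
Proof. by move=> pU pV; apply: Sigma01_eq; rewrite pU. Qed.

Lemma Pi01_names_fun p F G : Pi01_names p F -> Pi01_names p G -> F = G.
Proof. by move=> pF pG; apply: Pi01_eq; rewrite pF. Qed.

Lemma alpha_pair a r :
  alpha (npair a r) = [set x | mdist (nu X a) x < ratr (nu_posrat r)].
Proof. by rewrite /alpha /npair Cantor.cancel_of_to. Qed.

Lemma open_enumerated (U : set X) : open U -> exists p, U = enumerated p.
Proof.
move=> oU; exists (fun n => if `[< alpha n `<=` U >] then n.+1 else 0%N).
apply/seteqP; split => [x Ux|x [n /=]]; last first.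
  by case: ifPn => // /asboolP nU _; exact: nU.
have /nbhs_ballP[e /= e0 xeU] : nbhs x U by exact: open_nbhs_nbhs.
have [m] := ltr_add_invr (divr_gt0 e0 (ltr0Sn R 1)); rewrite add0r => em.
pose r : R := m.+1%:R^-1.
have r0 : 0 < r by rewrite invr_gt0.
have rE : ratr (nu_posrat (npair 0 m)) = r :> R.
  rewrite /nu_posrat /npair Cantor.cancel_of_to mul1r fmorphV.
  by rewrite -[RHS]/(m.+1%:R^-1) -[in RHS](ratr_nat R).
have [||y [/interior_subset + [a _ ay]]] := @nu_dense _ X (interior (ball x r)).
- by exists x; exact: (nbhsx_ballx x r).
- exact: open_interior.
rewrite ballEmdist /= metric_sym -ay => ax.
have nU : alpha (npair a (npair 0 m)) `<=` U.
  rewrite alpha_pair rE => z /= az.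
  apply: xeU; rewrite ballEmdist /= (splitr e).
  rewrite (le_lt_trans (metric_triangle _ (nu X a) _))// ltrD//.
    by rewrite metric_sym (lt_trans ax).
  by rewrite (lt_trans az).
exists (npair a (npair 0 m)); rewrite /= asboolT//=.
by rewrite alpha_pair /= rE.
Qed.

Lemma enumerated_open p : open (enumerated p).
Proof.
apply: bigcup_open => i _; rewrite /alpha; case: Cantor.of_nat => a r.
set e := ratr _; rewrite openE => x /= axe; apply/nbhs_ballP.
exists (e - mdist (nu X a) x) => /=; first by rewrite subr_gt0.
move=> y; rewrite ballEmdist /= ltrBrDl.
exact: le_lt_trans (metric_triangle _ _ _).
Qed.

Lemma Sigma01_names_total p : exists U, Sigma01_names p U.
Proof. by exists (OpenSet (enumerated_open p)). Qed.

Lemma Pi01_names_total p : exists F, Pi01_names p F.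
Proof. by exists (ClosedSet (open_closedC (enumerated_open p))). Qed.

Lemma Sigma01_names_onto U : exists p, Sigma01_names p U.
Proof. exact: (open_enumerated (open_set_open U)). Qed.

Lemma Pi01_names_onto F : exists p, Pi01_names p F.
Proof.
have [p Fp] := open_enumerated (closed_openC (@closed_set_closed F)).
by exists p; rewrite /Pi01_names -Fp setCK.
Qed.

Definition delta_Sigma01 : representation Sigma01 :=
  Representation Sigma01_names_fun Sigma01_names_onto.

Definition delta_Pi01 : representation Pi01 :=
  Representation Pi01_names_fun Pi01_names_onto.

End hyperspaces.

Section families.
Variables (I T : Type) (D : set I).
Implicit Types A B : I -> set T.

Definition is_cover A : Prop := \bigcup_(i in D) A i = setT.

Definition shrinking B A : Prop :=
  is_cover B /\ forall i, D i -> B i `<=` A i.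

Definition order_le A (n : nat) : Prop :=
  forall i : 'I_n.+1 -> I, injective i -> (forall j, D (i j)) ->
    \bigcap_(j in setT) A (i j) = set0.

End families.

Section operations.
Variables (R : realType) (X : computable_metric_space R) (N : nat).

(* The members of a word of sets; only indices below the length are used. *)
Definition opens (U : seq (Sigma01 X)) : nat -> set X :=
  nth set0 (map (@open_set R X) U).

Definition closeds (F : seq (Pi01 X)) : nat -> set X :=
  nth set0 (map (@closed_set R X) F).

Definition finite_covers : set (seq (Sigma01 X)) :=
  [set U | is_cover `I_(size U) (opens U)].

Definition infinite_covers : set (nat -> Sigma01 X) :=
  [set U | is_cover setT U].

Definition C_omega : multifun (nat -> Sigma01 X) (nat -> Sigma01 X) :=
  Multifun infinite_covers
    (fun U => [set W : nat -> Sigma01 X | shrinking setT W U /\ order_le setT W N.+1]).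

Definition C_star : multifun (seq (Sigma01 X)) (seq (Sigma01 X)) :=
  Multifun finite_covers
    (fun U => [set W | [/\ size W = size U,
      shrinking `I_(size U) (opens W) (opens U) &
      order_le `I_(size U) (opens W) N.+1]]).

Definition Cdot_star : multifun (seq (Sigma01 X)) (seq (Sigma01 X) * seq nat) :=
  Multifun finite_covers
    (fun U => [set Wr | let: (W, r) := Wr in
      [/\ size r = size W,
          forall j, (j < size W)%N -> (nth 0%N r j < size U)%N /\
            opens W j `<=` opens U (nth 0%N r j),
          is_cover `I_(size W) (opens W) &
          order_le `I_(size W) (opens W) N.+1]]).

Definition Cdot_omega :
    multifun (nat -> Sigma01 X) ((nat -> Sigma01 X) * baire) :=
  Multifun infinite_covers
    (fun U => [set Wr : (nat -> Sigma01 X) * baire | let: (W, r) := Wr in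
      [/\ forall j, W j `<=` U (r j), is_cover setT W &
          order_le setT W N.+1]]).

Definition Cbar : multifun (seq (Sigma01 X)) (seq (Pi01 X)) :=
  Multifun finite_covers
    (fun U => [set F | [/\ size F = size U,
      shrinking `I_(size U) (closeds F) (opens U) &
      order_le `I_(size U) (closeds F) N.+1]]).

Definition Cbardot : multifun (seq (Sigma01 X)) (seq (Pi01 X) * seq nat) :=
  Multifun finite_covers
    (fun U => [set Fr | let: (F, r) := Fr in
      [/\ size r = size F,
          forall j, (j < size F)%N -> (nth 0%N r j < size U)%N /\
            closeds F j `<=` opens U (nth 0%N r j),
          is_cover `I_(size F) (closeds F) &
          order_le `I_(size F) (closeds F) N.+1]]).

End operations.

(* Main.v *)
(** From [W_j] contained in [U_(r_j)] one passes to a shrinking by uniting the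
    [W_j] with the same [r_j], and back by taking for [r] the identity; a finite
    cover becomes an infinite one by adding empty sets.  For the passage between
    open and closed covers, let open sets [V_j] be given as unions of balls
    [B(a_(j,m), r_(j,m))].  Say that [x] is strictly (weakly) in [V_j] at level
    [k] if [d(a_(j,m), x) + 1/(k+1)] is less than (at most) [r_(j,m)] for some
    [m < k], and let [E_T,i] be the set of the points that, at some level, are
    not weakly in [V_i], but strictly in at least [T] of the [V_j].  It is open,
    and can be enumerated uniformly.  If [V_j = W_j] is an open cover, the
    complements of the [E_1,i] are a closed shrinking of it.  If the [V_j] are
    the complements of [K] closed sets [F_j] of order at most [N + 1], then the
    [E_(K-N-1),i] are open neighbourhoods of the [F_i], again of order at most
    [N + 1]: at the least level at which a point gets into some of them, it
    is strictly in [K-N-1] of the [V_j], hence weakly outside at most [N + 1].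
    Intersecting them with the given open sets makes them a refinement.

    Every output number is thus a primitive recursive function of the input, of
    the output of the given machine, and of approximations to the distances of
    the [nu i].  Such functionals are evaluated by while programs on counters,
    which a machine with one tape per counter executes; one further instruction
    makes a step of the given machine, whose tapes and state are embedded. *)

Require Import Defs.
From Stdlib Require Cantor.
From mathcomp Require Import all_boot all_order all_algebra.
From mathcomp Require Import all_classical reals topology.
From mathcomp Require Import lra.

Set Implicit Arguments.
Unset Strict Implicit.
Unset Printing Implicit Defensive.
Import Order.TTheory GRing.Theory Num.Theory.

(** * Compiling while programs to Type-2 machines *)

Definition tape_map (S S' : Type) (f : S -> S') (t : tape S) : tape S' :=
  (map (omap f) t.1, map (omap f) t.2).

Lemma tape_read_map S S' (f : S -> S') t :
  tape_read (tape_map f t) = omap f (tape_read t).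
Proof. by case: t => l [|x r]. Qed.

Lemma tape_write_map S S' (f : S -> S') x t :
  tape_write (omap f x) (tape_map f t) = tape_map f (tape_write x t).
Proof. by case: t => l [|y r]. Qed.

Lemma tape_move_map S S' (f : S -> S') m t :
  tape_move m (tape_map f t) = tape_map f (tape_move m t).
Proof. by case: m; case: t => [[|x l] [|y r]]. Qed.

Definition move_nat (m : move) (n : nat) : nat :=
  match m with Left => n.-1 | Stay => n | Right => n.+1 end.

(* The counter value is the distance of the head from the marked cell. *)
Definition counter_tape (S : Type) (mark : S) (n : nat) (t : tape S) : Prop :=
  exists k, t = if n is m.+1 then (rcons (nseq m None) (Some mark), nseq k None)
                else ([::], Some mark :: nseq k None).

Lemma counter_tape_read S (mark : S) n t :
  counter_tape mark n t -> tape_read t = if n is 0 then Some mark else None.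
Proof. by case=> k ->; case: n => // n; case: k. Qed.

Lemma counter_tape_init S (mark : S) :
  counter_tape mark 0 (tape_write (Some mark) ([::], [::])).
Proof. by exists 0. Qed.

(** A left move at the mark is replaced by [Stay], in accordance with [0.-1 = 0]. Apart from the
    distance, a move changes only the number [k] of explicit blanks on the right. *)
Lemma counter_tape_move S (mark : S) m n t : counter_tape mark n t ->
  counter_tape mark (move_nat m n)
    (tape_move (if (n == 0) && (if m is Left then true else false) then Stay else m)
       (tape_write (tape_read t) t)).
Proof.
move=> ct; rewrite (counter_tape_read ct); case: ct => k ->.
case: n => [|n].
  by case: m => /=; exists k.
case: m => /=; last 2 first.
- by exists k.-1.+1; case: k.
- by exists k.-1; case: k.
by case: n => [|n]; [exists k.-1.+1|exists k.-1.+2]; case: k.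
Qed.

(** A machine step writes on every tape, which makes a blank beyond the right list explicit;
    embedded tapes are therefore compared after rewriting the scanned cell. *)
Definition tape_norm (S : Type) (t : tape S) := tape_write (tape_read t) t.

Lemma tape_norm_map S S' (f : S -> S') t :
  tape_norm (tape_map f t) = tape_map f (tape_norm t).
Proof. by case: t => l [|x r]. Qed.

(** * While programs and their translation to code with jumps *)

Section Programs.
Variable M : type2_machine.

Inductive atom :=
| Inc of nat
| Dec of nat
| Read of nat
| Emit of bool
| Dev of nat & nat & nat & nat.

Record store := Store {
  rg : nat -> nat;
  dv : config M;
  ip : nat;
  out : seq bool
}.

Definition scanned (c : config M) := [ffun k => tape_read (ctapes c k)].

Definition is_read a := if a is Read _ then true else false.
Definition dev_bit (a : atom) (nz : nat -> bool) :=
  if a is Dev r _ _ _ then nz r else false.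

(* [Dev r v e b] lets the embedded machine make a step on the input symbol
   given by [r], and increments [v] if it advances its input head, [e] if it
   writes an output symbol and [b] if this symbol is [true]. *)
Definition atom_move (a : atom) (input adv : bool) (em : option bool) (r : nat) : move :=
  match a with
  | Inc r0 => if r == r0 then Right else Stay
  | Dec r0 => if r == r0 then Left else Stay
  | Read r0 => if (r == r0) && input then Right else Stay
  | Emit _ => Stay
  | Dev _ v e b =>
    if [|| (r == v) && adv, (r == e) && isSome em | (r == b) && (em == Some true)]
    then Right else Stay
  end.

(** [Dev] gives the embedded machine a constant input: whatever its position, it scans the bit taken
    from a register. *)
Definition atom_step (inp : nat -> bool) (a : atom) (s : store) : store :=
  let b := dev_bit a (fun r => rg s r != 0) in
  let q := cstate (dv s) in
  let sc := scanned (dv s) in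
  Store (fun r => move_nat
           (atom_move a (inp (ip s)) (advance q b sc) (emit q b sc) r) (rg s r))
        (if a is Dev _ _ _ _ then step (fun=> b) (dv s) else dv s)
        (ip s + is_read a)
        (out s ++ if a is Emit x then [:: x] else [::]).

Inductive cmd :=
| Skip
| Atom of atom
| Seq of cmd & cmd
| While of nat & cmd.

Section Exec.
Variable inp : nat -> bool.

Inductive exec : cmd -> store -> store -> Prop :=
| ExecSkip s : exec Skip s s
| ExecAtom a s : exec (Atom a) s (atom_step inp a s)
| ExecSeq c d s t u : exec c s t -> exec d t u -> exec (Seq c d) s u
| ExecStop r c s : rg s r = 0 -> exec (While r c) s s
| ExecLoop r c s t u : rg s r != 0 -> exec c s t -> exec (While r c) t u ->
    exec (While r c) s u.

Inductive instr :=
| IAtom of atom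
| IJz of nat & nat
| IJmp of nat.

Fixpoint csize (c : cmd) : nat :=
  match c with
  | Skip => 0
  | Atom _ => 1
  | Seq c d => csize c + csize d
  | While _ c => (csize c).+2
  end.

(** [l] is the absolute address at which the code is placed. *)
Fixpoint code (c : cmd) (l : nat) : seq instr :=
  match c with
  | Skip => [::]
  | Atom a => [:: IAtom a]
  | Seq c d => code c l ++ code d (l + csize c)
  | While r c => IJz r (l + (csize c).+2) :: rcons (code c l.+1) (IJmp l)
  end.

Lemma size_code c l : size (code c l) = csize c.
Proof.
elim: c l => [||c IHc d IHd|r c IHc] l //=; first by rewrite size_cat IHc IHd.
by rewrite size_rcons IHc.
Qed.

(** The default [IJmp 0] makes a program that runs off its end start again. *)
Definition istep (prog : seq instr) (cf : nat * store) : nat * store :=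
  let: (pc, s) := cf in
  match nth (IJmp 0) prog pc with
  | IAtom a => (pc.+1, atom_step inp a s)
  | IJz r l => (if rg s r == 0 then l else pc.+1, s)
  | IJmp l => (l, s)
  end.

Definition reaches prog cf cf' := exists n, iter n (istep prog) cf = cf'.

Lemma reaches_trans prog a b c : reaches prog a b -> reaches prog b c -> reaches prog a c.
Proof. by move=> [m <-] [n <-]; exists (n + m); rewrite iterD. Qed.

(** By induction on the execution. [prog] stays the whole program while [pre] and [post] vary, so
    each subcommand is found at its own address; the last jump of a loop leads back to the start,
    where the hypothesis on the remaining rounds applies. *)
Lemma code_correct c s t : exec c s t -> forall prog pre post,
  prog = pre ++ code c (size pre) ++ post ->
  reaches prog (size pre, s) (size pre + csize c, t).
Proof.
elim=> {c s t} [s|a s|c d s t u _ IHc _ IHd|r c s rs|r c s t u rs _ IHc _ IHw]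
  prog pre post progE.
- by exists 0; rewrite addn0.
- exists 1; rewrite /= progE nth_cat ltnn subnn /=.
  by rewrite addn1.
- move: progE; rewrite /= -catA => progE.
  apply: reaches_trans (IHc _ _ _ progE) _.
  move: (IHd prog (pre ++ code c (size pre)) post).
  by rewrite size_cat size_code -catA addnA; apply.
- by exists 1; rewrite /= progE nth_cat ltnn subnn /= rs eqxx.
- apply: reaches_trans (_ : reaches _ _ ((size pre).+1, s)) _.
    by exists 1; rewrite /= progE nth_cat ltnn subnn /= (negPf rs).
  apply: reaches_trans (_ : reaches _ _ ((size pre).+1 + csize c, t)) _.
    have := IHc prog (rcons pre (IJz r (size pre + (csize c).+2)))
      (IJmp (size pre) :: post).
    rewrite size_rcons; apply.
    by rewrite progE cat_rcons /= cat_rcons.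
  apply: reaches_trans (IHw _ _ _ progE).
  exists 1; rewrite /= progE nth_cat ltnNge ltnW ?ltnS ?leq_addr//=.
  rewrite addSn -addnS addKn /= nth_cat nth_rcons size_rcons size_code.
  by rewrite ltnSn ltnn eqxx.
Qed.

End Exec.

(** * A machine that executes a list of instructions, with one counter tape per register *)

Section Compile.
Variable prog : seq instr.
Let n := size prog.

Definition instr_regs (i : instr) : nat :=
  match i with
  | IAtom (Inc r) | IAtom (Dec r) | IAtom (Read r) | IJz r _ => r
  | IAtom (Dev a v e b) => maxn (maxn a v) (maxn e b)
  | _ => 0
  end.
Let nr := \max_(i <- prog) instr_regs i.

(** [None] is the starting state, in which the marks are written. The program counter may also equal
    [n], the end of the program. *)
Definition pstate : finType := (option 'I_n.+1 * state M)%type.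
Definition psymbol : finType := (unit + symbol M)%type.
Definition mark : psymbol := inl tt.

Definition instr_at (pc : 'I_n.+1) := nth (IJmp 0) prog pc.

Implicit Types (st : pstate) (b : bool)
  (a : {ffun 'I_(nr.+1 + ntapes M) -> option psymbol}).

Definition reg_nz a (r : nat) : bool := ~~ isSome (a (lshift _ (inord r : 'I_nr.+1))).
Definition dev_scan a : {ffun 'I_(ntapes M) -> option (symbol M)} :=
  [ffun k => obind (fun x : psymbol => if x is inr y then Some y else None)
     (a (rshift _ k))].

Definition pnext st b a : pstate :=
  if st.1 isn't Some pc then (Some (inord 0), st.2) else
  match instr_at pc with
  | IAtom x => (Some (inord pc.+1),
      if x is Dev _ _ _ _ then next_state st.2 (dev_bit x (reg_nz a)) (dev_scan a)
      else st.2)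
  | IJz r l => (Some (inord (if reg_nz a r then pc.+1 else l)), st.2)
  | IJmp l => (Some (inord l), st.2)
  end.

Definition padvance st b a : bool :=
  if st.1 is Some pc then if instr_at pc is IAtom x then is_read x else false
  else false.

Definition pemit st b a : option bool :=
  if st.1 is Some pc then if instr_at pc is IAtom (Emit x) then Some x else None
  else None.

Definition pwork st b a k : option psymbol * move :=
  match fintype.split k with
  | inl r =>
    if st.1 isn't Some pc then (Some mark, Stay) else
    (a k,
     if instr_at pc is IAtom x then
       let b' := dev_bit x (reg_nz a) in
       let m := atom_move x b (advance st.2 b' (dev_scan a))
                  (emit st.2 b' (dev_scan a)) r in
       if ~~ reg_nz a r && (if m is Left then true else false) then Stay else m
     else Stay)
  | inr j =>
    if st.1 is Some pc then
      if instr_at pc is IAtom (Dev _ _ _ _ as x) then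
        let w := work st.2 (dev_bit x (reg_nz a)) (dev_scan a) j in
        (omap inr w.1, w.2)
      else (a k, Stay)
    else (a k, Stay)
  end.

Definition pmachine : type2_machine :=
  @Type2Machine pstate (None, init M) psymbol (nr.+1 + ntapes M)
    pnext padvance pwork pemit.

(** Of the embedded machine only the state and the tapes are present in [c]; its position and output
    are left to the registers of the program. *)
Definition represents (c : config pmachine) (pc : nat) (s : store) : Prop :=
  [/\ cstate c = (Some (inord pc), cstate (dv s)) /\ pc <= n,
      cpos c = ip s, coutput c = out s,
      forall r : 'I_nr.+1, counter_tape mark (rg s r) (ctapes c (lshift _ r)) &
      forall j, tape_norm (ctapes c (rshift _ j)) =
                tape_map inr (tape_norm (ctapes (dv s) j))].

Definition instr_ok (i : instr) := match i with IJz _ l | IJmp l => l <= n | _ => true end.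

Lemma reg_nzE c pc s r : represents c pc s -> r <= nr ->
  reg_nz [ffun k => tape_read (ctapes c k)] r = (rg s r != 0).
Proof.
move=> [_ _ _ cr _] rn.
rewrite /reg_nz ffunE (counter_tape_read (cr _)) inordK//.
by case: (rg s r).
Qed.

Lemma dev_scanE c pc s : represents c pc s ->
  dev_scan [ffun k => tape_read (ctapes c k)] = scanned (dv s).
Proof.
move=> [_ _ _ _ cd]; apply/ffunP => j; rewrite !ffunE.
have : tape_read (ctapes c (rshift nr.+1 j)) = _ := congr1 (@tape_read _) (cd j).
rewrite tape_read_map => ->; rewrite -[tape_read (tape_norm _)]/(tape_read (ctapes (dv s) j)).
by case: (tape_read (ctapes (dv s) j)) => [?|].
Qed.

Lemma istep_represents inp c pc s : all instr_ok prog ->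
  represents c pc s ->
  let: (pc', s') := istep inp prog (pc, s) in
  represents (step inp c) pc' s'.
Proof.
move=> /(all_nthP (IJmp 0)) ok rep.
have [[cs pcn] cp co cr cd] := rep.
have pcK : (inord pc : 'I_n.+1) = pc :> nat by rewrite inordK// ltnS.
have := dev_scanE rep; have := reg_nzE rep.
set sc := [ffun k => _] => nzE dsE.
rewrite /istep.
have atE : instr_at (inord pc) = nth (IJmp 0) prog pc by rewrite /instr_at pcK.
(* At [pc = n] the instruction is the default jump; for all others [pc < n] keeps [pc.+1] in
   range. *)
have [regm okx] : instr_regs (nth (IJmp 0) prog pc) <= nr /\
    instr_ok (nth (IJmp 0) prog pc) &&
    (if nth (IJmp 0) prog pc is IJmp _ then true else pc < n).
  move: pcn; rewrite leq_eqVlt => /predU1P[->|pcn].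
    by rewrite nth_default.
  split; last by rewrite ok//; case: nth.
  rewrite /nr (big_nth (IJmp 0)) big_mkord.
  exact: (leq_bigmax (Ordinal pcn)).
case: (nth _ prog pc) atE regm okx => [x|r l|l] atE regm /andP[/= okx pcx]; last 2 first.
- rewrite /represents /step /= /pnext /padvance /pemit /pwork cs /= atE /=.
  rewrite nzE//; split => /=.
  + by rewrite pcK; case: (rg s r == 0).
  + by rewrite addn0.
  + by rewrite cats0.
  + move=> i; rewrite (unsplitK (inl i : 'I_nr.+1 + 'I__)).
    have := counter_tape_move Stay (cr i).
    by rewrite andbF /sc ffunE.
  + move=> j; rewrite (unsplitK (inr j : 'I_nr.+1 + 'I__)) -cd.
    by rewrite /sc ffunE.
- rewrite /represents /step /= /pnext /padvance /pemit /pwork cs /= atE /=.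
  split => //=.
  + by rewrite addn0.
  + by rewrite cats0.
  + move=> i; rewrite (unsplitK (inl i : 'I_nr.+1 + 'I__)).
    have := counter_tape_move Stay (cr i).
    by rewrite andbF /sc ffunE.
  + move=> j; rewrite (unsplitK (inr j : 'I_nr.+1 + 'I__)) -cd.
    by rewrite /sc ffunE.
have dbE : dev_bit x (reg_nz sc) = dev_bit x (fun r => rg s r != 0).
  case: x regm {atE okx} => //= a v e b; rewrite !geq_max => /andP[/andP[+ _] _].
  exact: nzE.
rewrite /represents /step /= /pnext /padvance /pemit /pwork cs /= atE /= dbE dsE.
split => //=.
- by rewrite pcK; split=> //; case: (x).
- by rewrite cp.
- by rewrite co; case: (x).
- move=> i; rewrite (unsplitK (inl i : 'I_nr.+1 + 'I__)) nzE; last by rewrite -ltnS.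
  rewrite negbK cp.
  set m := atom_move _ _ _ _ _.
  have := counter_tape_move m (cr i).
  by rewrite /sc ffunE.
- move=> j; rewrite (unsplitK (inr j : 'I_nr.+1 + 'I__)).
  case: x {regm atE okx} dbE => [r|r|r|b|a v e b] dbE; last first.
    set w := work (cstate (dv s)) (rg s a != 0) (scanned (dv s)) j.
    (* Writing overwrites the scanned cell, so the tape may be normalized beforehand. *)
    transitivity (tape_map inr
        (tape_norm (tape_move w.2 (tape_write w.1 (tape_norm (ctapes (dv s) j))))) :
      tape psymbol); last by [].
    by rewrite -tape_norm_map -tape_move_map -tape_write_map -cd.
  all: by rewrite -cd /sc ffunE.
Qed.

Lemma istep_represents_iter inp c s k : all instr_ok prog -> represents c s.1 s.2 ->
  let: (pc', s') := iter k (istep inp prog) s in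
  represents (iter k (step inp) c) pc' s'.
Proof.
move=> ok rep; elim: k => [|k] /=; first by case: s rep.
case: (iter k (istep inp prog) s) => pc' s'.
exact: istep_represents.
Qed.

Lemma step_initial_represents inp :
  represents (step inp (initial pmachine)) 0 (Store (fun=> 0) (initial M) 0 [::]).
Proof.
split => //=.
- move=> r; rewrite /pwork (unsplitK (inl r : 'I_nr.+1 + 'I__)).
  exact: counter_tape_init.
- by move=> j; rewrite /pwork (unsplitK (inr j : 'I_nr.+1 + 'I__)) ffunE.
Qed.

End Compile.

Lemma code_ok c l m : l + csize c <= m ->
  all (fun i => match i with IJz _ l | IJmp l => l <= m | _ => true end) (code c l).
Proof.
elim: c l => [|a|c IHc d IHd|r c IHc] l //=.
  by move=> lm; rewrite all_cat IHc ?IHd// -?addnA// (leq_trans _ lm)// leq_add2l leq_addr.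
move=> lm; rewrite lm all_rcons (leq_trans _ lm) ?leq_addr//=.
by rewrite IHc// (leq_trans _ lm)// addSnnS leq_add2l.
Qed.

(** [exec] only describes terminating runs. An infinite computation is therefore given by the stores
    [s i] between successive executions of [c], which the machine strings together by restarting at
    the end of the code. *)
Lemma loop_machine (c : cmd) : exists M', forall inp (s : nat -> store),
  s 0 = Store (fun=> 0) (initial M) 0 [::] ->
  (forall i, exec inp c (s i) (s i.+1)) ->
  forall i, exists t, coutput (run M' inp t) = out (s i).
Proof.
exists (pmachine (code c 0)) => inp s s0 sS i.
suff [t [_ _ + _ _]] : exists t, represents (run (pmachine (code c 0)) inp t) 0 (s i).
  by exists t.
have ok : all (@instr_ok (code c 0)) (code c 0) by apply: code_ok; rewrite size_code.
elim: i => [|i [t it]]; first by exists 1; rewrite s0; exact: step_initial_represents.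
have [|k] := @code_correct inp c _ _ (sS i) (code c 0) [::] [::]; first by rewrite cats0.
(* One more step, the default jump, returns to address 0. *)
move=> /(congr1 (istep inp (code c 0))).
rewrite -iterS => kE; exists (k.+1 + t).
have := @istep_represents_iter _ inp _ (0, s i) k.+1 ok it.
by rewrite kE /= nth_default ?size_code// /run iterD.
Qed.

End Programs.

(** * Composition of machines *)

Lemma unary_prefixS p n :
  unary_prefix p n.+1 = unary_prefix p n ++ rcons (nseq (p n) true) false.
Proof.
by rewrite /unary_prefix -addn1 iotaD map_cat flatten_cat /= cats0.
Qed.

Lemma unary_prefix_le p m n : m <= n -> prefix (unary_prefix p m) (unary_prefix p n).
Proof.
move=> /subnKC <-; elim: (n - m) => [|k IH]; first by rewrite addn0 prefix_refl.
by rewrite addnS unary_prefixS; apply: prefix_trans IH (prefix_prefix _ _).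
Qed.

Lemma size_unary_prefix p n : n <= size (unary_prefix p n).
Proof.
elim: n => // n IH; rewrite unary_prefixS size_cat size_rcons addnS ltnS.
by rewrite (leq_trans IH)// leq_addr.
Qed.

Lemma nth_prefix (T : eqType) (x : T) s t i : prefix s t ->
  i < size s -> nth x t i = nth x s i.
Proof. by move=> /prefixP[u ->] si; rewrite nth_cat si. Qed.

Lemma nth_unary_prefix p n i : i < size (unary_prefix p n) ->
  nth false (unary_prefix p n) i = unary p i.
Proof.
move=> ip; rewrite /unary; have ii := size_unary_prefix p i.+1.
have [ni|/ltnW ni] := leqP n i.+1; first exact: esym (nth_prefix false (unary_prefix_le p ni) ip).
by have := nth_prefix false (unary_prefix_le p ni) ii.
Qed.

Lemma unary_at p i u : u <= p i ->
  unary p (size (unary_prefix p i) + u) = (u < p i).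
Proof.
move=> up; rewrite -(@nth_unary_prefix _ i.+1); last first.
  by rewrite unary_prefixS size_cat size_rcons size_nseq ltn_add2l ltnS.
rewrite unary_prefixS nth_cat ltnNge leq_addr /= addKn nth_rcons size_nseq nth_nseq.
by case: ltngtP up.
Qed.

Lemma coutput_mono M inp t k :
  prefix (coutput (run M inp t)) (coutput (run M inp (k + t))).
Proof.
elim: k => [|k IH]; first exact: prefix_refl.
rewrite addSn /run iterS /step /=.
exact: prefix_trans IH (prefix_prefix _ _).
Qed.

(** Each number contributes at least its terminating [false]. *)
Lemma output_unbounded M p q k : machine_function M p q ->
  exists t, k < size (coutput (run M (unary p) t)).
Proof.
move=> /(_ k.+1) [t /size_prefix kt]; exists t.
exact: leq_trans (size_unary_prefix _ _) kt.
Qed.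

(** The output at time [t] and a prefix of the encoding of [q] that is longer than [i] are both
    prefixes of one later output. *)
Lemma output_nth M p q t i : machine_function M p q ->
  i < size (coutput (run M (unary p) t)) ->
  nth false (coutput (run M (unary p) t)) i = unary q i.
Proof.
move=> /(_ i.+1) [t' it'] it; have iq := size_unary_prefix q i.+1.
rewrite -(nth_unary_prefix iq) -(nth_prefix false it' iq).
rewrite -(nth_prefix false (coutput_mono M (unary p) t t') it) addnC.
apply: nth_prefix (coutput_mono M (unary p) t' t) _.
exact: leq_trans iq (size_prefix it').
Qed.

(** * Two machines coupled by a buffer of one symbol *)

Section Composition.
Variables M1 M2 : type2_machine.

Definition xstate : finType := (state M1 * state M2 * option bool)%type.
Definition xsymbol : finType := (symbol M1 + symbol M2)%type.

Implicit Types (st : xstate) (b : bool)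
  (a : {ffun 'I_(ntapes M1 + ntapes M2) -> option xsymbol}).

Definition scan1 a : {ffun 'I_(ntapes M1) -> option (symbol M1)} :=
  [ffun k => obind (fun x : xsymbol => if x is inl y then Some y else None)
     (a (lshift _ k))].
Definition scan2 a : {ffun 'I_(ntapes M2) -> option (symbol M2)} :=
  [ffun k => obind (fun x : xsymbol => if x is inr y then Some y else None)
     (a (rshift _ k))].

Definition xnext st b a : xstate :=
  if st.2 is Some x then
    (st.1.1, next_state st.1.2 x (scan2 a),
     if advance st.1.2 x (scan2 a) then None else Some x)
  else (next_state st.1.1 b (scan1 a), st.1.2, emit st.1.1 b (scan1 a)).

Definition xadvance st b a : bool :=
  if st.2 is Some x then false else advance st.1.1 b (scan1 a).

Definition xemit st b a : option bool :=
  if st.2 is Some x then emit st.1.2 x (scan2 a) else None.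

Definition xwork st b a k : option xsymbol * move :=
  match fintype.split k, st.2 with
  | inl j, None => let w := work st.1.1 b (scan1 a) j in (omap inl w.1, w.2)
  | inr j, Some x => let w := work st.1.2 x (scan2 a) j in (omap inr w.1, w.2)
  | _, _ => (a k, Stay)
  end.

(* The pending symbol of the state is the part of the output of [M1] that [M2]
   has not yet consumed; [M1] only runs when there is none. *)
Definition xmachine : type2_machine :=
  @Type2Machine xstate (init M1, init M2, None) xsymbol (ntapes M1 + ntapes M2)
    xnext xadvance xwork xemit.

Record xrep (c : config xmachine) (c1 : config M1) (c2 : config M2) buf : Prop := XRep {
  xrep_state : cstate c = (cstate c1, cstate c2, buf);
  xrep_pos : cpos c = cpos c1;
  xrep_out : coutput c = coutput c2;
  xrep_tape1 : forall j, tape_norm (ctapes c (lshift _ j)) =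
    tape_map inl (tape_norm (ctapes c1 j));
  xrep_tape2 : forall j, tape_norm (ctapes c (rshift _ j)) =
    tape_map inr (tape_norm (ctapes c2 j))
}.

Lemma scan1E c c1 c2 buf : xrep c c1 c2 buf ->
  scan1 [ffun k => tape_read (ctapes c k)] = scanned c1.
Proof.
move=> rep; apply/ffunP => j; rewrite !ffunE.
have : tape_read (ctapes c (lshift _ j)) = _ := congr1 (@tape_read _) (xrep_tape1 rep j).
rewrite tape_read_map => ->; rewrite -[tape_read (tape_norm _)]/(tape_read (ctapes c1 j)).
by case: (tape_read (ctapes c1 j)).
Qed.

Lemma scan2E c c1 c2 buf : xrep c c1 c2 buf ->
  scan2 [ffun k => tape_read (ctapes c k)] = scanned c2.
Proof.
move=> rep; apply/ffunP => j; rewrite !ffunE.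
have : tape_read (ctapes c (rshift _ j)) = _ := congr1 (@tape_read _) (xrep_tape2 rep j).
rewrite tape_read_map => ->; rewrite -[tape_read (tape_norm _)]/(tape_read (ctapes c2 j)).
by case: (tape_read (ctapes c2 j)).
Qed.

Lemma xstep1 inp c c1 c2 : xrep c c1 c2 None ->
  xrep (step inp c) (step inp c1) c2 (emit (cstate c1) (inp (cpos c1)) (scanned c1)).
Proof.
move=> rep; have [cs cp co ct1 ct2] := rep; have aE := scan1E rep.
split; rewrite /= /xnext /xadvance /xemit /xwork ?cs ?cp /= ?aE ?cats0//.
- move=> j; rewrite (unsplitK (inl j : 'I__ + 'I__)) /=.
  set w := work _ _ _ j.
  transitivity (tape_map inl
      (tape_norm (tape_move w.2 (tape_write w.1 (tape_norm (ctapes c1 j))))) :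
    tape xsymbol); last by [].
  by rewrite -tape_norm_map -tape_move_map -tape_write_map -ct1.
- by move=> j; rewrite (unsplitK (inr j : 'I__ + 'I__)) /= -ct2 ffunE.
Qed.

Lemma xstep2 inp inp2 c c1 c2 x : xrep c c1 c2 (Some x) -> inp2 (cpos c2) = x ->
  xrep (step inp c) c1 (step inp2 c2)
    (if advance (cstate c2) x (scanned c2) then None else Some x).
Proof.
move=> rep xE; have [cs cp co ct1 ct2] := rep; have aE := scan2E rep.
split; rewrite /= /xnext /xadvance /xemit /xwork ?cs ?cp /= ?aE ?addn0 ?xE ?co//.
- by move=> j; rewrite (unsplitK (inl j : 'I__ + 'I__)) /= -ct1 ffunE.
- move=> j; rewrite (unsplitK (inr j : 'I__ + 'I__)) /=.
  set w := work _ _ _ j.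
  transitivity (tape_map inr
      (tape_norm (tape_move w.2 (tape_write w.1 (tape_norm (ctapes c2 j))))) :
    tape xsymbol); last by [].
  by rewrite -tape_norm_map -tape_move_map -tape_write_map -ct2.
Qed.

(** Before every step of [M2], even one that does not advance its head, [M1] runs until a symbol is
    pending. It always succeeds because its output is unbounded. *)
Lemma xmachine_correct p q r : machine_function M1 p q -> machine_function M2 q r ->
  machine_function xmachine p r.
Proof.
move=> M1pq M2qr.
pose c1 t := run M1 (unary p) t; pose c2 t := run M2 (unary q) t.
(* [M2] has consumed all that [M1] has written except for the pending symbol, which is the one that
   [M2] scans on the input [q]. *)
pose good T t1 t2 buf := xrep (run xmachine (unary p) T) (c1 t1) (c2 t2) buf /\
  size (coutput (c1 t1)) = cpos (c2 t2) + isSome buf /\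
  forall x, buf = Some x -> unary q (cpos (c2 t2)) = x.
have fill T t1 t2 : good T t1 t2 None -> exists T' t1' x, good T' t1' t2 (Some x).
  (* At time [t'] the output of [M1] is longer than what [M2] has consumed, so a symbol is pending
     at [t'] at the latest. *)
  have [t' t'E] := output_unbounded (cpos (c2 t2)) M1pq.
  elim: {t1}(t' - t1) {-2}t1 (leqnn (t' - t1)) T => [|k IH] t1 t1k T.
    case=> _ [/= sE _]; move: t'E; rewrite -[cpos _]addn0 -sE.
    have [u uE] := prefixP (coutput_mono M1 (unary p) t' (t1 - t')).
    move: t1k; rewrite leqn0 subn_eq0 => t1k; move: uE; rewrite subnK// /c1 => ->.
    by rewrite size_cat ltnNge leq_addr.
  case=> [rep [sE _]]; rewrite /= addn0 in sE.
  have := xstep1 (unary p) rep.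
  have outE : coutput (c1 t1.+1) = coutput (c1 t1) ++
    seq_of_opt (emit (cstate (c1 t1)) (unary p (cpos (c1 t1))) (scanned (c1 t1))) by [].
  case: (emit _ _ _) outE => [x|] outE rep'.
    exists T.+1, t1.+1, x; split; first exact: rep'.
    split; first by rewrite outE size_cat sE.
    move=> _ [<-]; rewrite -(@output_nth _ _ _ t1.+1 _ M1pq) -/(c1 t1.+1) outE.
      by rewrite nth_cat sE ltnn subnn.
    by rewrite size_cat sE /= addn1.
  apply: (IH t1.+1 _ T.+1); first by rewrite subnS; case: (t' - t1) t1k.
  split; first exact: rep'.
  by rewrite outE cats0 sE addn0.
have reach t2 : exists T t1 buf, good T t1 t2 buf.
  elim: t2 => [|t2 [T [t1 [buf IH]]]].
    exists 0, 0, None; split=> //; split=> // j; rewrite /tape_norm//=.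
  have [T' [t1' [x [rep [sE xE]]]]] : exists T' t1' x, good T' t1' t2 (Some x).
    by case: buf IH => [x|]; [exists T, t1, x|exact: fill].
  have := xstep2 (unary p) rep (xE _ erefl).
  set buf' := (if _ then _ else _) => rep'.
  exists T'.+1, t1', buf'; split; first exact: rep'.
  rewrite /c2 /run iterS -/(run _ _ _) -/(c2 t2) /= (xE _ erefl) /buf' sE /=.
  rewrite -/(scanned _).
  case: (advance _ _ _) => /=; first by rewrite addn0.
  by rewrite addn0; split=> // y [<-]; exact: xE.
move=> n; have [t2 nt2] := M2qr n; have [T [t1 [buf [rep _]]]] := reach t2.
by exists T; rewrite (xrep_out rep).
Qed.

End Composition.

(** * Primitive recursive functionals *)

(** Variables are de Bruijn indices: in the last argument of [Iter], 0 is the accumulator and 1 the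
    counter. [Ren] is there for weakening, [Orc] queries one of two oracles. *)
Inductive expr :=
| Var of nat
| Zero
| Succ of expr
| Pred of expr
| Orc of bool & expr
| Ren of (nat -> nat) & expr
| Iter of expr & expr & expr.

Definition scons (a : nat) (env : nat -> nat) : nat -> nat :=
  fun i => if i is j.+1 then env j else a.

(** The counter runs downwards, as in a loop that decrements a register. *)
Fixpoint cdrec (f : nat -> nat -> nat) (n acc : nat) : nat :=
  if n is m.+1 then cdrec f m (f m acc) else acc.

Fixpoint interp (O : bool -> baire) (env : nat -> nat) (e : expr) : nat :=
  match e with
  | Var i => env i
  | Zero => 0
  | Succ e => (interp O env e).+1
  | Pred e => (interp O env e).-1
  | Orc b e => O b (interp O env e)
  | Ren r e => interp O (fun i => env (r i)) e
  | Iter n z s => cdrec (fun m acc => interp O (scons acc (scons m env)) s)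
                    (interp O env n) (interp O env z)
  end.

(** The expression is data: the closure lemmas build it, and [sval] passes it to the compiler.
    Predicates count as functionals with values 0 and 1. *)
Definition def (f : (bool -> baire) -> (nat -> nat) -> nat) : Type :=
  {e : expr | forall O env, interp O env e = f O env}.

Definition bsum (n : nat) (h : nat -> nat) : nat := \sum_(i < n) h i.
Definition bhas (n : nat) (P : nat -> bool) : bool := has P (iota 0 n).
Definition ballb (n : nat) (P : nat -> bool) : bool := all P (iota 0 n).

Lemma cdrec_sum h n acc : cdrec (fun m a => a + h m) n acc = acc + bsum n h.
Proof.
rewrite /bsum; elim: n acc => [|n IH] acc /=; first by rewrite big_ord0 addn0.
by rewrite IH big_ord_recr /= -addnA (addnC (h n)).
Qed.

Lemma cdrec_iter (f : nat -> nat) n acc : cdrec (fun _ => f) n acc = iter n f acc.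
Proof. by elim: n acc => //= n IH acc; rewrite IH -iterSr. Qed.

Lemma cdrec_foldr f n acc : cdrec f n acc = foldr f acc (iota 0 n).
Proof.
elim: n acc => // n IH acc.
by rewrite -[in RHS]addn1 iotaD foldr_cat -IH.
Qed.

Lemma bhasE n P : bhas n P = (bsum n (fun i => P i) != 0).
Proof.
rewrite /bhas /bsum -(big_mkord xpredT (fun i => nat_of_bool (P i))) /index_iota subn0.
by elim: (iota 0 n) => [|i s IH] /=; rewrite ?big_nil// big_cons IH; case: (P i).
Qed.

Section Closure.
Implicit Types f g h : (bool -> baire) -> (nat -> nat) -> nat.
Implicit Types P Q : (bool -> baire) -> (nat -> nat) -> bool.

Lemma def_ext f g : (forall O e, f O e = g O e) -> def f -> def g.
Proof. by move=> fg [x xE]; exists x => O e; rewrite xE fg. Qed.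

Lemma def_var i : def (fun O e => e i).
Proof. by exists (Var i). Qed.

Lemma def_const c : def (fun O e => c).
Proof. by elim: c => [|c [x xE]]; [exists Zero|exists (Succ x) => O e /=; rewrite xE]. Qed.

Lemma def_succ f : def f -> def (fun O e => (f O e).+1).
Proof. by move=> [x xE]; exists (Succ x) => O e /=; rewrite xE. Qed.

Lemma def_pred f : def f -> def (fun O e => (f O e).-1).
Proof. by move=> [x xE]; exists (Pred x) => O e /=; rewrite xE. Qed.

Lemma def_orc b f : def f -> def (fun O e => O b (f O e)).
Proof. by move=> [x xE]; exists (Orc b x) => O e /=; rewrite xE. Qed.

Lemma def_ren r f : def f -> def (fun O e => f O (fun i => e (r i))).
Proof. by move=> [x xE]; exists (Ren r x) => O e /=; rewrite xE. Qed.

Lemma def_cdrec f g (s : (bool -> baire) -> (nat -> nat) -> nat -> nat -> nat) :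
  def f -> def g ->
  def (fun O e => s O (fun i => e i.+2) (e 1) (e 0)) ->
  def (fun O e => cdrec (s O e) (f O e) (g O e)).
Proof.
move=> [x xE] [y yE] [z zE]; exists (Iter x y z) => O e /=; rewrite xE yE.
by congr cdrec; apply/funext => m; apply/funext => a; rewrite zE.
Qed.

Lemma def_iter f g (s : (bool -> baire) -> (nat -> nat) -> nat -> nat) :
  def f -> def g -> def (fun O e => s O (fun i => e i.+1) (e 0)) ->
  def (fun O e => iter (f O e) (s O e) (g O e)).
Proof.
move=> df dg ds; apply: def_ext (fun O e => cdrec_iter (s O e) (f O e) (g O e)) _.
apply: (@def_cdrec _ _ (fun O e _ => s O e)) => //.
(* The renaming skips index 1, which holds the counter. *)
exact: (def_ren (fun i => if i is j.+1 then j.+2 else 0) ds).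
Qed.

Lemma def_add f g : def f -> def g -> def (fun O e => f O e + g O e).
Proof.
move=> df dg; apply: def_ext (def_iter dg df (s := fun _ _ => succn) _).
  by move=> O e; rewrite iter_succn.
exact: def_succ (def_var 0).
Qed.

Lemma def_sub f g : def f -> def g -> def (fun O e => f O e - g O e).
Proof.
move=> df dg; apply: def_ext (def_iter dg df (s := fun _ _ => predn) _).
  by move=> O e; rewrite iter_predn.
exact: def_pred (def_var 0).
Qed.

Lemma def_mul f g : def f -> def g -> def (fun O e => f O e * g O e).
Proof.
move=> df dg.
apply: def_ext (def_iter dg (def_const 0) (s := fun O e => addn (f O e)) _).
  by move=> O e; rewrite iter_addn_0.
exact: def_add (def_ren succn df) (def_var 0).
Qed.

Lemma def_exp f g : def f -> def g -> def (fun O e => f O e ^ g O e).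
Proof.
move=> df dg.
apply: def_ext (def_iter dg (def_const 1) (s := fun O e => muln (f O e)) _).
  by move=> O e; rewrite iter_muln_1.
exact: def_mul (def_ren succn df) (def_var 0).
Qed.

Lemma def_double f : def f -> def (fun O e => (f O e).*2).
Proof. by move=> df; apply: def_ext (def_add df df) => O e; rewrite addnn. Qed.

Lemma def_sum f (h : (bool -> baire) -> (nat -> nat) -> nat -> nat) :
  def f -> def (fun O e => h O (fun i => e i.+1) (e 0)) ->
  def (fun O e => bsum (f O e) (h O e)).
Proof.
move=> df dh.
apply: def_ext (def_cdrec df (def_const 0) (s := fun O e m a => a + h O e m) _).
  by move=> O e; rewrite cdrec_sum.
exact: def_add (def_var 0) (def_ren succn dh).
Qed.

Lemma def_leq f g : def f -> def g -> def (fun O e => f O e <= g O e).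
Proof.
move=> df dg; apply: def_ext (def_sub (def_const 1) (def_sub df dg)) => O e.
by rewrite /leq; case: (f O e - g O e) => [|n]; rewrite ?subSS ?sub0n.
Qed.

Lemma def_and P Q : def P -> def Q -> def (fun O e => P O e && Q O e).
Proof.
by move=> dP dQ; apply: def_ext (def_mul dP dQ) => O e; rewrite mulnb.
Qed.

Lemma def_neg P : def P -> def (fun O e => ~~ P O e).
Proof.
by move=> dP; apply: def_ext (def_sub (def_const 1) dP) => O e; case: (P O e).
Qed.

Lemma def_eqn f g : def f -> def g -> def (fun O e => f O e == g O e).
Proof.
move=> df dg; apply: def_ext (def_and (def_leq df dg) (def_leq dg df)) => O e.
by rewrite eqn_leq.
Qed.

Lemma def_if P f g : def P -> def f -> def g ->
  def (fun O e => if P O e then f O e else g O e).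
Proof.
move=> dP df dg.
apply: def_ext (def_add (def_mul dP df) (def_mul (def_neg dP) dg)) => O e.
by case: (P O e); rewrite mul1n mul0n ?addn0 ?add0n.
Qed.

Lemma def_has f (P : (bool -> baire) -> (nat -> nat) -> nat -> bool) :
  def f -> def (fun O e => P O (fun i => e i.+1) (e 0)) ->
  def (fun O e => bhas (f O e) (P O e)).
Proof.
move=> df dP.
apply: def_ext (def_neg (def_eqn (def_sum df dP (h := fun O e i => P O e i)) (def_const 0))).
by move=> O e; rewrite bhasE.
Qed.

Lemma def_ball f (P : (bool -> baire) -> (nat -> nat) -> nat -> bool) :
  def f -> def (fun O e => P O (fun i => e i.+1) (e 0)) ->
  def (fun O e => ballb (f O e) (P O e)).
Proof.
move=> df dP.
apply: def_ext (def_neg (def_has df (def_neg dP) (P := fun O e i => ~~ P O e i))).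
by move=> O e; rewrite /ballb /bhas has_predC negbK.
Qed.
End Closure.

(** * Pairing, codes of words, and their inverses *)

Lemma npairE i j : npair i j = j + bsum (j + i) succn.
Proof.
rewrite /npair /= /bsum -[(j + i)%coq_nat]/(j + i); congr (_ + _); elim: (j + i) => [|k IH] /=.
  by rewrite big_ord0.
by rewrite big_ord_recr /= -IH addnC.
Qed.

(** The recursion step of [CodeSeq.code], that is, cons on codes of words. *)
Definition push (x y : nat) : nat := 2 ^ x * y.*2.+1.

Lemma pushE x s : push x (ncode s) = ncode (x :: s).
Proof. by []. Qed.

(** A bounded search written as a sum. For an injective [P] with [i, j <= P i j], only the preimage
    of [n] can contribute, and it lies below the bound. *)
Definition inv1 (P : nat -> nat -> nat) (n : nat) : nat :=
  bsum n.+1 (fun i => i * bsum n.+1 (fun j => P i j == n)).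
Definition inv2 (P : nat -> nat -> nat) (n : nat) : nat :=
  bsum n.+1 (fun i => bsum n.+1 (fun j => j * (P i j == n))).

Lemma bsum_only (h : nat -> nat) n k : k < n -> (forall i, i != k -> h i = 0) -> bsum n h = h k.
Proof.
move=> kn hk; rewrite /bsum (bigD1 (Ordinal kn))//= big1 ?addn0// => i ik.
by apply: hk; apply: contra ik => /eqP ik; apply/eqP/val_inj.
Qed.

Section Inverse.
Variable P : nat -> nat -> nat.
Hypothesis P_inj : forall i j i' j', P i j = P i' j' -> i = i' /\ j = j'.
Hypothesis P_le : forall i j, i <= P i j /\ j <= P i j.

Lemma inv1E i j : inv1 P (P i j) = i.
Proof.
have [iP jP] := P_le i j.
rewrite /inv1 (@bsum_only _ _ i)// => [|k ki].
  rewrite (@bsum_only _ _ j) ?eqxx ?muln1// => k kj.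
  by apply/eqP; rewrite eqb0; apply: contra kj => /eqP/P_inj[_ ->].
rewrite /bsum big1 ?muln0// => l _.
by apply/eqP; rewrite eqb0; apply: contra ki => /eqP/P_inj[->].
Qed.

Lemma inv2E i j : inv2 P (P i j) = j.
Proof.
have [iP jP] := P_le i j.
rewrite /inv2 (@bsum_only _ _ i)// => [|k ki].
  rewrite (@bsum_only _ _ j) ?eqxx ?muln1// => k kj.
  by apply/eqP; rewrite muln_eq0 eqb0; apply/orP; right; apply: contra kj => /eqP/P_inj[_ ->].
rewrite /bsum big1// => l _.
by apply/eqP; rewrite muln_eq0 eqb0; apply/orP; right; apply: contra ki => /eqP/P_inj[->].
Qed.
End Inverse.

Lemma npair_inj i j i' j' : npair i j = npair i' j' -> i = i' /\ j = j'.
Proof. by move=> /Cantor.to_nat_inj[-> ->]. Qed.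

Lemma npair_le i j : i <= npair i j /\ j <= npair i j.
Proof.
have /ssrnat.leP := Cantor.to_nat_non_decreasing i j.
by rewrite -/(npair i j) => h; split; apply: leq_trans h; rewrite ?leq_addl ?leq_addr.
Qed.

Lemma push_inj i j i' j' : push i j = push i' j' -> i = i' /\ j = j'.
Proof.
rewrite -(CodeSeq.decodeK j) -(CodeSeq.decodeK j') !pushE.
by move=> /(can_inj CodeSeq.codeK)[-> ->].
Qed.

Lemma push_le i j : i <= push i j /\ j <= push i j.
Proof.
rewrite /push; split.
  by apply: leq_trans (ltnW (ltn_expl i (ltnSn 1))) _; rewrite leq_pmulr.
apply: (@leq_trans j.*2.+1); first by rewrite -addnn -addnS leq_addr.
by rewrite leq_pmull// expn_gt0.
Qed.

Definition nfst := inv1 npair.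
Definition nsnd := inv2 npair.
Definition nhd := inv1 push.
Definition ntl := inv2 push.

Lemma nfstE i j : nfst (npair i j) = i. Proof. exact: inv1E npair_inj npair_le _ _. Qed.
Lemma nsndE i j : nsnd (npair i j) = j. Proof. exact: inv2E npair_inj npair_le _ _. Qed.
Lemma nhdE x s : nhd (ncode (x :: s)) = x.
Proof. exact: inv1E push_inj push_le _ _. Qed.
Lemma ntlE x s : ntl (ncode (x :: s)) = ncode s.
Proof. exact: inv2E push_inj push_le _ _. Qed.

Definition nnth (w i : nat) : nat := nhd (iter i ntl w).

Lemma nnthE s i : i < size s -> nnth (ncode s) i = nth 0 s i.
Proof.
elim: s i => // x s IH [|i] /=; first by rewrite /nnth /= nhdE.
by rewrite ltnS => /IH <-; rewrite /nnth iterSr ntlE.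
Qed.

(** [S] codes a list of length [L] with the last number in front, so number [i] stands at place
    [L - i.+1]. *)
Definition lookup (i L S : nat) : nat := nnth S (L - i.+1).

Lemma lookupE (p : baire) i L : i < L -> lookup i L (ncode (rev (mkseq p L))) = p i.
Proof.
move=> iL; rewrite /lookup nnthE ?size_rev ?size_mkseq; last first.
  by rewrite ltn_subrL/= (leq_trans _ iL).
have lL : L - i.+1 < L by rewrite ltn_subrL /= (leq_trans _ iL).
have E : L - (L - i.+1).+1 = i by rewrite subnSK// subKn// ltnW.
by rewrite nth_rev size_mkseq// E nth_mkseq.
Qed.

Lemma push_mkseq (p : baire) L :
  push (p L) (ncode (rev (mkseq p L))) = ncode (rev (mkseq p L.+1)).
Proof. by rewrite mkseqS rev_rcons pushE. Qed.

(** Since [cdrec] counts down, the pushes leave the numbers in increasing order; 0 is the code of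
    the empty word. *)
Definition nword_iota (k : nat) := cdrec (fun m acc => push m acc) k 0.

Lemma nword_iotaE k : nword_iota k = ncode (iota 0 k).
Proof. by rewrite /nword_iota cdrec_foldr; elim: (iota 0 k) => //= x s ->. Qed.

Section Closure2.
Implicit Types f g h : (bool -> baire) -> (nat -> nat) -> nat.

Lemma def_pair f g : def f -> def g -> def (fun O e => npair (f O e) (g O e)).
Proof.
move=> df dg; apply: def_ext (fun O e => esym (npairE (f O e) (g O e))) _.
apply: def_add => //; apply: (@def_sum _ (fun _ _ => succn)); first exact: def_add.
exact: def_succ (def_var 0).
Qed.

Lemma def_push f g : def f -> def g -> def (fun O e => push (f O e) (g O e)).
Proof.
by move=> df dg; exact: def_mul (def_exp (def_const 2) df) (def_succ (def_double dg)).
Qed.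

Lemma def_inv1 P f : (forall f g, def f -> def g -> def (fun O e => P (f O e) (g O e))) ->
  def f -> def (fun O e => inv1 P (f O e)).
Proof.
move=> dP df; apply: (@def_sum _ (fun O e i => i * _)); first exact: def_succ.
apply: def_mul; first exact: def_var.
apply: (@def_sum _ (fun O e j => P (e 0) j == f O (fun i => e i.+1))).
  exact: def_succ (def_ren succn df).
apply: def_eqn; last exact: (def_ren succn (def_ren succn df)).
exact: dP (def_var 1) (def_var 0).
Qed.

Lemma def_inv2 P f : (forall f g, def f -> def g -> def (fun O e => P (f O e) (g O e))) ->
  def f -> def (fun O e => inv2 P (f O e)).
Proof.
move=> dP df.
apply: (@def_sum _ (fun O e i => bsum (f O e).+1 (fun j => j * (P i j == f O e)))).
  exact: def_succ.
apply: (@def_sum _ (fun O e j => j * (P (e 0) j == f O (fun i => e i.+1)))).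
  exact: def_succ (def_ren succn df).
apply: def_mul (def_var 0) _.
apply: def_eqn; last exact: (def_ren succn (def_ren succn df)).
exact: dP (def_var 1) (def_var 0).
Qed.

Lemma def_nfst f : def f -> def (fun O e => nfst (f O e)).
Proof. exact: def_inv1 def_pair. Qed.

Lemma def_nsnd f : def f -> def (fun O e => nsnd (f O e)).
Proof. exact: def_inv2 def_pair. Qed.

Lemma def_nhd f : def f -> def (fun O e => nhd (f O e)).
Proof. exact: def_inv1 def_push. Qed.

Lemma def_ntl f : def f -> def (fun O e => ntl (f O e)).
Proof. exact: def_inv2 def_push. Qed.

Lemma def_nnth f g : def f -> def g -> def (fun O e => nnth (f O e) (g O e)).
Proof.
move=> df dg; apply: def_nhd; apply: (@def_iter _ _ (fun _ _ => ntl)) => //.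
exact: def_ntl (def_var 0).
Qed.

Lemma def_lookup f g h : def f -> def g -> def h ->
  def (fun O e => lookup (f O e) (g O e) (h O e)).
Proof.
by move=> df dg dh; exact: def_nnth dh (def_sub dg (def_succ df)).
Qed.

Lemma def_nword_iota f : def f -> def (fun O e => nword_iota (f O e)).
Proof.
move=> df; apply: (@def_cdrec _ _ (fun _ _ => push) df (def_const 0)).
exact: def_push (def_var 1) (def_var 0).
Qed.

End Closure2.

Ltac def_tac :=
  lazymatch goal with
  | |- def (fun O e => e _) => exact: def_var
  | |- def (fun O e => O _ _) => apply: def_orc; def_tac
  | |- def (fun O e => S _) => apply: def_succ; def_tac
  | |- def (fun O e => predn _) => apply: def_pred; def_tac
  | |- def (fun O e => addn _ _) => apply: def_add; def_tac
  | |- def (fun O e => subn _ _) => apply: def_sub; def_tac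
  | |- def (fun O e => muln _ _) => apply: def_mul; def_tac
  | |- def (fun O e => expn _ _) => apply: def_exp; def_tac
  | |- def (fun O e => double _) => apply: def_double; def_tac
  | |- def (fun O e => nat_of_bool (leq _ _)) => apply: def_leq; def_tac
  | |- def (fun O e => nat_of_bool (_ && _)) => apply: def_and; def_tac
  | |- def (fun O e => nat_of_bool (~~ _)) => apply: def_neg; def_tac
  | |- def (fun O e => nat_of_bool (_ == _)) => apply: def_eqn; def_tac
  | |- def (fun O e => nat_of_bool (bhas _ _)) => apply: def_has; def_tac
  | |- def (fun O e => nat_of_bool (ballb _ _)) => apply: def_ball; def_tac
  | |- def (fun O e => if _ then _ else _) => apply: def_if; def_tac
  | |- def (fun O e => bsum _ _) => apply: def_sum; def_tac
  | |- def (fun O e => npair _ _) => apply: def_pair; def_tac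
  | |- def (fun O e => push _ _) => apply: def_push; def_tac
  | |- def (fun O e => nfst _) => apply: def_nfst; def_tac
  | |- def (fun O e => nsnd _) => apply: def_nsnd; def_tac
  | |- def (fun O e => nnth _ _) => apply: def_nnth; def_tac
  | |- def (fun O e => lookup _ _ _) => apply: def_lookup; def_tac
  | |- def (fun O e => nword_iota _) => apply: def_nword_iota; def_tac
  | |- _ => exact: def_const
  end.

(** * Compiling functionals to while programs *)

Section Commands.
Variable M : type2_machine.
Variable inp : nat -> bool.
Implicit Types (s t : store M) (c : cmd) (r d v : nat).

Definition setr s r v : store M :=
  Store (fun x => if x == r then v else rg s x) (dv s) (ip s) (out s).

Lemma exec_inc r s : exec inp (Atom (Inc r)) s (setr s r (rg s r).+1).
Proof.
rewrite [setr _ _ _](_ : _ = atom_step inp (Inc r) s); first exact: ExecAtom.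
rewrite /atom_step /setr /= cats0 addn0; congr Store; apply/funext => x.
by case: eqP => // ->.
Qed.

Lemma exec_dec r s : exec inp (Atom (Dec r)) s (setr s r (rg s r).-1).
Proof.
rewrite [setr _ _ _](_ : _ = atom_step inp (Dec r) s); first exact: ExecAtom.
rewrite /atom_step /setr /= cats0 addn0; congr Store; apply/funext => x.
by case: eqP => // ->.
Qed.

Lemma setr_same s r v : rg s r = v -> setr s r v = s.
Proof.
by case: s => f d i o /= <-; congr Store; apply/funext => x /=; case: eqP => // ->.
Qed.

Lemma setr_setr s r v w : setr (setr s r v) r w = setr s r w.
Proof. by congr Store; apply/funext => x /=; case: eqP. Qed.

Lemma rg_setr s r v : rg (setr s r v) r = v.
Proof. by rewrite /= eqxx. Qed.

Definition clear r := While r (Atom (Dec r)).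

Lemma exec_clear r s : exec inp (clear r) s (setr s r 0).
Proof.
elim: {s}(rg s r) {-2}s (erefl (rg s r)) => [|n IH] s sr.
  by rewrite setr_same//; exact: ExecStop.
apply: ExecLoop (exec_dec r s) _; first by rewrite sr.
by rewrite -[X in exec _ _ _ X](setr_setr s r n) sr; apply: IH; rewrite rg_setr.
Qed.

Definition pour d r := While d (Seq (Atom (Dec d)) (Atom (Inc r))).

Lemma exec_pour d r s : d != r ->
  exec inp (pour d r) s (setr (setr s r (rg s r + rg s d)) d 0).
Proof.
move=> dr; elim: {s}(rg s d) {-2}s (erefl (rg s d)) => [|n IH] s sd.
  by rewrite sd addn0 (setr_same (r := r))// setr_same//; exact: ExecStop.
apply: ExecLoop (ExecSeq (exec_dec d s) (exec_inc r _)) _; first by rewrite sd.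
set s' := setr _ _ _.
have s'd : rg s' d = n by rewrite /s' /= (negPf dr) sd eqxx.
have s'r : rg s' r = (rg s r).+1 by rewrite /s' /= eqxx eq_sym (negPf dr).
have := IH _ s'd; rewrite s'd s'r sd.
congr (exec _ _ _ _); congr Store; apply/funext => x /=.
case: (x =P d) => // xd; case: (x =P r) => // _.
by rewrite addSnnS.
Qed.

Definition move_reg d r := Seq (clear r) (pour d r).

Lemma exec_move_reg d r s : d != r ->
  exec inp (move_reg d r) s (setr (setr s r (rg s d)) d 0).
Proof.
move=> dr; apply: ExecSeq (exec_clear _ _) _.
have := exec_pour (setr s r 0) dr.
rewrite rg_setr setr_setr /= (negPf dr); exact.
Qed.

(** Reading a counter destroys it, so [i] is emptied into both [d] and the auxiliary [k], and then
    restored from [k]. *)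
Definition copy i d k :=
  Seq (clear d) (Seq (clear k)
    (Seq (While i (Seq (Atom (Dec i)) (Seq (Atom (Inc d)) (Atom (Inc k))))) (pour k i))).

Lemma exec_copy i d k s : i != d -> i != k -> d != k ->
  exec inp (copy i d k) s (setr (setr s d (rg s i)) k 0).
Proof.
move=> id ik dk; pose f n a u := setr (setr (setr s i n) d a) k u.
have fi n a u : rg (f n a u) i = n by rewrite /= (negPf id) (negPf ik) eqxx.
have fd n a u : rg (f n a u) d = a by rewrite /= (negPf dk) eqxx.
have fk n a u : rg (f n a u) k = u by rewrite /= eqxx.
have loop n a : exec inp (While i (Seq (Atom (Dec i)) (Seq (Atom (Inc d)) (Atom (Inc k)))))
    (f n a a) (f 0 (a + n) (a + n)).
  elim: n a => [|n IH] a; first by rewrite addn0; apply: ExecStop.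
  apply: ExecLoop; first by rewrite fi.
    apply: ExecSeq (exec_dec _ _) (ExecSeq (exec_inc _ _) (exec_inc _ _)).
  rewrite addnS -addSn; have := IH a.+1; congr (exec _ _ _ _).
  congr Store; apply/funext => x /=.
  rewrite (negPf id) (negPf ik) (eq_sym d i) (negPf id) (negPf dk) (eq_sym k i) (negPf ik).
  rewrite (eq_sym k d) (negPf dk) !eqxx.
  by case: (x =P k) => // _; case: (x =P d) => // _; case: (x =P i).
do 2 apply: ExecSeq (exec_clear _ _) _.
apply: (@ExecSeq _ _ _ _ _ (f 0 (rg s i) (rg s i))).
  have := loop (rg s i) 0; congr (exec _ _ _ _).
  congr Store; apply/funext => x /=.
  by case: (x =P k) => // _; case: (x =P d) => // _; case: (x =P i) => [->|].
have ki : k != i by rewrite eq_sym.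
have := exec_pour (f 0 (rg s i) (rg s i)) ki; rewrite fi fk.
congr (exec _ _ _ _); congr Store; apply/funext => x /=.
case: (x =P k) => // _; case: (x =P i) => [->|//].
by rewrite (negPf id).
Qed.

(** * Evaluation of expressions in registers *)

Section Compile.
Variable query : bool -> nat -> cmd.

(** The value is left in register [d], and apart from queries only registers from [d] on are
    changed. Variables that [rs] sends to [None] have the value 0; renamings cost no code. *)
Fixpoint compile (rs : nat -> option nat) (d : nat) (e : expr) : cmd :=
  match e with
  | Var i => if rs i is Some r then copy r d d.+1 else clear d
  | Zero => clear d
  | Succ e => Seq (compile rs d e) (Atom (Inc d))
  | Pred e => Seq (compile rs d e) (Atom (Dec d))
  | Orc b e => Seq (compile rs d e) (query b d)
  | Ren f e => compile (fun i => rs (f i)) d e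
  | Iter n z e => Seq (compile rs d n) (Seq (compile rs d.+1 z)
      (Seq (While d (Seq (Atom (Dec d))
         (Seq (compile (fun i => match i with 0 => Some d.+1 | 1 => Some d | j.+2 => rs j end)
                 d.+2 e) (move_reg d.+2 d.+1))))
        (move_reg d.+1 d)))
  end.

Definition env_of (rs : nat -> option nat) s : nat -> nat :=
  fun i => if rs i is Some r then rg s r else 0.

Variables (O : bool -> baire) (I : store M -> Prop) (pr : pred nat) (R0 : nat).
Hypothesis I_setr : forall s r v, R0 <= r -> I s -> I (setr s r v).
Hypothesis pr_R0 : forall r, R0 <= r -> pr r.
Hypothesis query_correct : forall b d s, R0 <= d -> I s -> exists s',
  [/\ exec inp (query b d) s s', I s', rg s' d = O b (rg s d) &
      forall r, r < d -> pr r -> rg s' r = rg s r].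

(** A query may change variables of the simulation. Hence only registers satisfying [pr] are
    promised to be kept, and [I] is the invariant under which queries are answered. *)
Lemma compile_correct e rs d s : R0 <= d ->
  (forall i r, rs i = Some r -> r < d /\ pr r) -> I s -> exists s',
  [/\ exec inp (compile rs d e) s s', I s', rg s' d = interp O (env_of rs s) e &
      forall r, r < d -> pr r -> rg s' r = rg s r].
Proof.
elim: e rs d s => [i||e IH|e IH|b e IH|f e IH|n IHn z IHz e IHe]
  rs d s Rd rsd Is /=.
- rewrite /env_of; case E : (rs i) => [r|].
    have [rd _] := rsd _ _ E.
    exists (setr (setr s d (rg s r)) d.+1 0); split.
    + by apply: exec_copy; rewrite ltn_eqF ?ltnS ?(ltnW rd).
    + by do 2 (apply: I_setr; first by rewrite ?leqW).
    + by rewrite /= ltn_eqF// eqxx.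
    + by move=> x xd _; rewrite /= !ltn_eqF// ltnS ltnW.
  exists (setr s d 0); split; [exact: exec_clear|exact: I_setr|by rewrite rg_setr|].
  by move=> x xd _; rewrite /= ltn_eqF.
- exists (setr s d 0); split; [exact: exec_clear|exact: I_setr|by rewrite rg_setr|].
  by move=> x xd _; rewrite /= ltn_eqF.
- have [s1 [x1 I1 v1 f1]] := IH rs d s Rd rsd Is.
  exists (setr s1 d (rg s1 d).+1); split; [exact: ExecSeq x1 (exec_inc _ _)|exact: I_setr| |].
    by rewrite rg_setr v1.
  by move=> x xd px; rewrite /= ltn_eqF// f1.
- have [s1 [x1 I1 v1 f1]] := IH rs d s Rd rsd Is.
  exists (setr s1 d (rg s1 d).-1); split; [exact: ExecSeq x1 (exec_dec _ _)|exact: I_setr| |].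
    by rewrite rg_setr v1.
  by move=> x xd px; rewrite /= ltn_eqF// f1.
- have [s1 [x1 I1 v1 f1]] := IH rs d s Rd rsd Is.
  have [s2 [x2 I2 v2 f2]] := query_correct b Rd I1.
  exists s2; split; [exact: ExecSeq x1 x2|by []|by rewrite v2 v1|].
  by move=> x xd px; rewrite f2// f1.
- by have [|s1 s1P] := IH (fun i => rs (f i)) d s Rd _ Is; [move=> i r /rsd|exists s1].
have [s1 [x1 I1 v1 f1]] := IHn rs d s Rd rsd Is.
have [||s2 [x2 I2 v2 f2]] := IHz rs d.+1 s1 _ _ I1; first exact: leqW.
  by move=> i r /rsd[rd pr_r]; split=> //; exact: leqW.
have envE s' : (forall r, r < d -> pr r -> rg s' r = rg s r) -> env_of rs s' = env_of rs s.
  move=> f; apply/funext => i; rewrite /env_of; case E : (rs i) => [r|//].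
  by have [rd pr_r] := rsd _ _ E; exact: f.
set body := Seq (Atom (Dec d)) _.
(* Register [d] is the counter and [d.+1] the accumulator. The body is evaluated in [d.+2] after the
   decrement, so that it sees the same counter as in [cdrec]. *)
have loop k : forall s', I s' -> rg s' d = k ->
    (forall r, r < d -> pr r -> rg s' r = rg s r) -> exists s'',
    [/\ exec inp (While d body) s' s'', I s'',
      rg s'' d.+1 = cdrec (fun m acc => interp O (scons acc (scons m (env_of rs s))) e) k
                      (rg s' d.+1) &
      forall r, r < d -> pr r -> rg s'' r = rg s r].
  elim: k => [|k IH] s' Is' s'd fs'; first by exists s'; split=> //; exact: ExecStop.
  set rs' := (fun i => match i with 0 => Some d.+1 | 1 => Some d | j.+2 => rs j end).
  pose s3 := setr s' d (rg s' d).-1.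
  have I3 : I s3 by exact: I_setr.
  have f3 r : r < d -> pr r -> rg s3 r = rg s r.
    by move=> rd pr_r; rewrite /= ltn_eqF// fs'.
  have [||s4 [x4 I4 v4 f4]] := IHe rs' d.+2 s3 _ _ I3.
  + by rewrite !leqW.
  + move=> [|[|i]] r /=; [case=> <-|case=> <-|move=> /rsd[rd pr_r]].
    * by split=> //; apply: pr_R0; exact: leqW.
    * by split; [exact: leqW|exact: pr_R0].
    * by rewrite !leqW.
  have dd : d < d.+2 by rewrite leqW.
  have [|||s5 [x5 I5 v5 f5]] := IH (setr (setr s4 d.+1 (rg s4 d.+2)) d.+2 0).
  + by do 2 (apply: I_setr; first by rewrite ?leqW).
  + rewrite /= !ltn_eqF// f4// ?rg_setr ?s'd//; exact: pr_R0.
  + move=> r rd pr_r; rewrite /= !ltn_eqF ?leqW// f4 ?f3// !leqW//.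
  exists s5; split=> //.
  + apply: ExecLoop x5; first by rewrite s'd.
    apply: ExecSeq (exec_dec _ _) (ExecSeq x4 _).
    by apply: exec_move_reg; rewrite neq_ltn ltnSn orbT.
  + rewrite v5 /= ltn_eqF// eqxx v4; congr cdrec; congr interp; apply/funext => -[|[|i]] /=.
    * by rewrite /env_of /= gtn_eqF.
    * by rewrite /env_of /= eqxx s'd.
    * by rewrite -(envE s3).
have [||s3 [x3 I3 v3 f3]] := loop (rg s1 d) s2 I2.
- by rewrite f2//; exact: pr_R0.
- by move=> r rd pr_r; rewrite f2 ?f1// leqW.
exists (setr (setr s3 d (rg s3 d.+1)) d.+1 0); split.
- apply: ExecSeq x1 (ExecSeq x2 (ExecSeq x3 _)).
  by apply: exec_move_reg; rewrite neq_ltn ltnSn orbT.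
- by do 2 (apply: I_setr; first by rewrite ?leqW).
- by rewrite /= ltn_eqF// eqxx v3 v2 v1 envE.
- by move=> r rd pr_r; rewrite /= !ltn_eqF ?f3// ltnS ltnW.
Qed.

End Compile.

(** * Input, output, and assignments to the fixed variables *)

Definition set_ip s n : store M := Store (rg s) (dv s) n (out s).

Lemma exec_read r s :
  exec inp (Atom (Read r)) s (set_ip (setr s r (rg s r + inp (ip s))) (ip s).+1).
Proof.
rewrite [set_ip _ _](_ : _ = atom_step inp (Read r) s); first exact: ExecAtom.
rewrite /atom_step /set_ip /= cats0 addn1; congr Store; apply/funext => x.
by case: eqP => //= ->; case: (inp (ip s)); rewrite ?addn1 ?addn0.
Qed.

Lemma exec_emit b s :
  exec inp (Atom (Emit b)) s (Store (rg s) (dv s) (ip s) (rcons (out s) b)).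
Proof.
rewrite [Store _ _ _ _](_ : _ = atom_step inp (Emit b) s); first exact: ExecAtom.
by rewrite /atom_step /= cats1 addn0.
Qed.

Definition regs (l : seq nat) : nat -> option nat := nth None (map Some l).

(* Registers below 19 are the fixed variables of the simulation: 0 counts the
   numbers written; 1 and 2 hold the length and the code (last number first) of
   the list of the numbers read so far; 3 and 4 the position of the input head
   of [M] (index of the current number, and offset in it); 5 the number of
   symbols [true] written by [M] after the last number, and 6 and 7 the length
   and the code of the list of the numbers written by [M]; 8 and 12 the index of
   the number of the input, respectively of the output of [M], to be fetched,
   and 9 and 13 how many numbers must be obtained before. *)
Definition nvars := 19.

Definition keeps d s s' := forall x, nvars <= x -> x < d -> rg s' x = rg s x.

Lemma keeps_trans d s s' s'' : keeps d s s' -> keeps d s' s'' -> keeps d s s''.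
Proof. by move=> k k' x xn xd; rewrite k'// k. Qed.

Definition assign r l d e := Seq (compile (fun _ _ => Skip) (regs l) d e) (move_reg d r).

Lemma regsP l i r : regs l i = Some r -> r \in l.
Proof.
rewrite /regs => E; have [il|il] := ltnP i (size l); last first.
  by move: E; rewrite nth_default ?size_map.
by move: E; rewrite (nth_map 0)// => -[<-]; exact: mem_nth.
Qed.

(** With [Skip] as query both oracles are the identity, so the compiler can be used with an
    invariant saying merely that nothing below [d] has changed. *)
Lemma exec_pure l d f (df : def f) s : all (fun x => x < nvars) l ->
  nvars <= d -> exists s',
  [/\ exec inp (compile (fun _ _ => Skip) (regs l) d (sval df)) s s',
      [/\ dv s' = dv s, ip s' = ip s & out s' = out s],
      rg s' d = f (fun _ x => x) (env_of (regs l) s) &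
      forall x, x < d -> rg s' x = rg s x].
Proof.
move=> ln nd.
pose I s' := [/\ dv s' = dv s, ip s' = ip s, out s' = out s &
  forall x, x < d -> rg s' x = rg s x].
have [||||||s1 [x1 [dv1 ip1 out1 f1] v1 _]] :=
  @compile_correct (fun _ _ => Skip) (fun _ x => x) I xpredT d _ _ _ (sval df) (regs l) d s.
- move=> s' r' v rd [? ? ? f']; split=> // x xd; rewrite /= ltn_eqF ?f'//.
  exact: leq_trans xd rd.
- by [].
- by move=> b d' s' _ I'; exists s'; split=> //; exact: ExecSkip.
- by [].
- by move=> i x /regsP/(allP ln) xn; split=> //; exact: leq_trans xn nd.
- by [].
by exists s1; split=> //; rewrite v1 (svalP df).
Qed.

Lemma exec_assign r l d f (df : def f) s : r < nvars -> all (fun x => x < nvars) l ->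
  nvars <= d -> exists s',
  [/\ exec inp (assign r l d (sval df)) s s',
      [/\ dv s' = dv s, ip s' = ip s & out s' = out s],
      forall x, x < nvars -> rg s' x =
        if x == r then f (fun _ x => x) (env_of (regs l) s) else rg s x &
      keeps d s s'].
Proof.
move=> rn ln nd; have rd : r < d := leq_trans rn nd.
have [s1 [x1 [dv1 ip1 out1] v1 f1]] := exec_pure df s ln nd.
exists (setr (setr s1 r (rg s1 d)) d 0); split=> //.
- by apply: ExecSeq x1 _; apply: exec_move_reg; rewrite gtn_eqF.
- move=> x xn; have xd := leq_trans xn nd.
  by rewrite /= (ltn_eqF xd) v1 f1.
- by move=> x xn xd; rewrite /= (ltn_eqF xd) (gtn_eqF (leq_trans rn xn)) f1.
Qed.

End Commands.

(** * Reading the input number by number *)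

Definition readnum : cmd :=
  Seq (clear 10) (Seq (clear 11) (Seq (Atom (Read 11))
    (While 11 (Seq (Atom (Dec 11)) (Seq (Atom (Inc 10)) (Atom (Read 11))))))).

Lemma def_guard : def (fun O e => (e 0).+1 - e 1). Proof. def_tac. Qed.
Lemma def_push01 : def (fun O e => push (e 0) (e 1)). Proof. def_tac. Qed.
Lemma def_lookup012 : def (fun O e => lookup (e 0) (e 1) (e 2)). Proof. def_tac. Qed.

Definition fetch_p d : cmd :=
  Seq (assign 9 [:: 8; 1] d (sval def_guard))
    (While 9 (Seq readnum (Seq (assign 2 [:: 10; 2] d (sval def_push01))
       (Seq (Atom (Inc 1)) (Atom (Dec 9)))))).

Section Fetch.
Variables (M : type2_machine) (p : baire).
Implicit Types (s : store M).

Lemma exec_readnum L s : ip s = size (unary_prefix p L) ->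
  exec (unary p) readnum s
    (set_ip (setr (setr s 10 (p L)) 11 0) (size (unary_prefix p L.+1))).
Proof.
move=> ips.
(* The store after [u.+1] symbols of the current block: [u] symbols [true] have been counted in
   register 10, and the last symbol read is in register 11. *)
pose F u := set_ip (setr (setr s 10 u) 11 (u < p L)) (size (unary_prefix p L) + u).+1.
have loop k : forall u, u + k = p L ->
    exec (unary p) (While 11 (Seq (Atom (Dec 11)) (Seq (Atom (Inc 10)) (Atom (Read 11)))))
      (F u) (F (p L)).
  elim: k => [|k IH] u uk.
    by rewrite -uk addn0; apply: ExecStop; rewrite /= -uk addn0 ltnn.
  have up : u < p L by rewrite -uk addnS ltnS leq_addr.
  apply: ExecLoop; first by rewrite /= up.
    apply: ExecSeq (exec_dec _ _ _) (ExecSeq (exec_inc _ _ _) (exec_read _ _ _)).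
  have := IH u.+1; rewrite addSnnS => /(_ uk); congr (exec _ _ _ _).
  rewrite /F /set_ip /= -!addnS unary_at// up addnS; congr Store; apply/funext => x /=.
  by case: (x =P 11) => //; case: (x =P 10) => // ->.
do 2 apply: ExecSeq (exec_clear _ _ _) _.
apply: ExecSeq (exec_read _ _ _) _.
have := loop (p L) 0 erefl; congr (exec _ _ _ _).
  rewrite /F /set_ip /= addn0 ips; congr Store; apply/funext => x /=.
  by rewrite -[size _]addn0 unary_at//; case: (x =P 11).
rewrite /F ltnn unary_prefixS size_cat size_rcons size_nseq addnS.
by [].
Qed.

Definition inv_p s := rg s 2 = ncode (rev (mkseq p (rg s 1))) /\
  ip s = size (unary_prefix p (rg s 1)).

(** The input tape is one-way, so all numbers read are kept, and reading goes on only until the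
    index in register 8 is covered. *)
Lemma exec_fetch_p d s : nvars <= d -> inv_p s -> exists s',
  [/\ exec (unary p) (fetch_p d) s s',
      [/\ inv_p s', rg s' 8 < rg s' 1, dv s' = dv s & out s' = out s],
      forall x, x < nvars -> x \notin [:: 1; 2; 9; 10; 11] -> rg s' x = rg s x &
      keeps d s s'].
Proof.
move=> nd Is.
have [//|//|s1 [x1 [dv1 ip1 out1] f1 k1]] :=
  @exec_assign M (unary p) 9 [:: 8; 1] d _ def_guard s _ _ nd.
have I1 : inv_p s1 by rewrite /inv_p ip1 !f1.
have g1 : rg s1 9 = (rg s1 8).+1 - rg s1 1 by rewrite !f1.
suff loop k : forall s1, inv_p s1 -> k = (rg s1 8).+1 - rg s1 1 -> rg s1 9 = k -> exists s',
  [/\ exec (unary p) (While 9 (Seq readnum (Seq (assign 2 [:: 10; 2] d (sval def_push01))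
       (Seq (Atom (Inc 1)) (Atom (Dec 9)))))) s1 s',
      [/\ inv_p s', rg s' 8 < rg s' 1, dv s' = dv s1 & out s' = out s1],
      forall x, x < nvars -> x \notin [:: 1; 2; 9; 10; 11] -> rg s' x = rg s1 x &
      keeps d s1 s'].
  have [s' [x' [I' l' dv' out'] f' k']] := loop _ _ I1 g1 erefl.
  exists s'; split; first exact: ExecSeq x1 x'.
  - by split=> //; rewrite ?dv' ?out'.
  - move=> x xn xl; rewrite f'// f1//.
    by case: eqP xl => // ->.
  - exact: keeps_trans k1 k'.
elim: k => [|k IH] {s1 x1 dv1 ip1 out1 f1 k1 I1 g1} {}s1 I1 gk g1.
  exists s1; split=> //; first exact: ExecStop.
  by split=> //; rewrite -subn_eq0 -gk.
have [p1 i1] := I1.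
have x2 := exec_readnum i1; set s2 := set_ip _ _ in x2.
have [//|//|s3 [x3 [dv3 ip3 out3] f3 k3]] :=
  @exec_assign M (unary p) 2 [:: 10; 2] d _ def_push01 s2 _ _ nd.
pose s4 := setr (setr s3 1 (rg s3 1).+1) 9 (rg s3 9).-1.
have f4 x : x < nvars -> rg s4 x = if x == 9 then k else if x == 1 then (rg s1 1).+1 else
    if x == 2 then push (p (rg s1 1)) (rg s1 2) else
    if x == 11 then 0 else if x == 10 then p (rg s1 1) else rg s1 x.
  move=> xn; rewrite /= !f3//= g1.
  by case: (x =P 9) => // _; case: (x =P 1).
have [|||s' [x' [I' l' dv' out'] f' k']] := IH s4.
- by rewrite /inv_p !f4//= p1 push_mkseq /s4 /= ip3.
- have le1 : rg s1 1 <= rg s1 8 by rewrite -ltnS -subn_gt0 -gk.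
  by rewrite !f4//= subSS; move: gk; rewrite subSn// => -[].
- by rewrite f4.
exists s'; split.
- apply: ExecLoop; first by rewrite g1.
    by apply: ExecSeq x2 (ExecSeq x3 (ExecSeq (exec_inc _ _ _) (exec_dec _ _ _))).
  exact: x'.
- by split=> //; rewrite ?dv' ?out' /= ?dv3 ?out3.
- move=> x xn xl; rewrite f'// f4//.
  by move: xl; rewrite !inE !negb_or => /and5P[/negPf-> /negPf-> /negPf-> /negPf-> /negPf->].
- move=> x xn xd; have nx i : i < nvars -> (x == i) = false.
    by move=> iv; rewrite gtn_eqF// (leq_trans iv).
  by rewrite k'// /= !nx// k3//= !nx.
Qed.

End Fetch.

(** * Running the given machine on demand *)

Lemma def_id0 : def (fun O e => e 0). Proof. def_tac. Qed.
(** Nonzero exactly when the offset is less than the current number, that is, when the scanned unary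
    symbol is [true]. *)
Lemma def_bit : def (fun O e => lookup (e 0) (e 1) (e 2) - e 3). Proof. def_tac. Qed.
(** Advancing over [false] moves to the next number and resets the offset; advancing over [true]
    only increases the offset. *)
Lemma def_index : def (fun O e => e 0 + e 2 * (1 - e 1)). Proof. def_tac. Qed.
Lemma def_offset : def (fun O e => (e 0 + e 2) * (1 - e 2 * (1 - e 1))). Proof. def_tac. Qed.
Lemma def_sub01 : def (fun O e => e 0 - e 1). Proof. def_tac. Qed.
Lemma def_add01 : def (fun O e => e 0 + e 1). Proof. def_tac. Qed.
Lemma def_push_if : def (fun O e => if e 2 == 0 then e 0 else push (e 1) (e 0)).
Proof. def_tac. Qed.
Lemma def_count : def (fun O e => (e 0 + e 1) * (1 - e 2)). Proof. def_tac. Qed.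

Definition seqs := foldr Seq Skip.

(** Register 14 holds the scanned symbol, 15 tells whether the head advances, 16 and 17 whether any
    symbol, respectively [true], is written. Hence 18 signals [false], the end of a number. *)
Definition mstep d : cmd := seqs [::
  assign 8 [:: 3] d (sval def_id0);
  fetch_p d;
  assign 14 [:: 8; 1; 2; 4] d (sval def_bit);
  clear 15; clear 16; clear 17;
  Atom (Dev 14 15 16 17);
  assign 3 [:: 3; 14; 15] d (sval def_index);
  assign 4 [:: 4; 14; 15] d (sval def_offset);
  assign 18 [:: 16; 17] d (sval def_sub01);
  assign 7 [:: 7; 5; 18] d (sval def_push_if);
  assign 6 [:: 6; 18] d (sval def_add01);
  assign 5 [:: 5; 17; 18] d (sval def_count);
  assign 13 [:: 13; 18] d (sval def_sub01)].

Definition fetch_q d : cmd :=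
  Seq (assign 13 [:: 12; 6] d (sval def_guard)) (While 13 (mstep d)).

Definition query b d : cmd :=
  if b then Seq (move_reg d 12) (Seq (fetch_q d)
    (compile (fun _ _ => Skip) (regs [:: 12; 6; 7]) d (sval def_lookup012)))
  else Seq (move_reg d 8) (Seq (fetch_p d)
    (compile (fun _ _ => Skip) (regs [:: 8; 1; 2]) d (sval def_lookup012))).

Section Queries.
Variables (M : type2_machine) (p q : baire).
Hypothesis Mpq : machine_function M p q.
Implicit Types (s : store M).

Definition inv_m t s := [/\ dv s = run M (unary p) t,
  cpos (dv s) = size (unary_prefix p (rg s 3)) + rg s 4,
  rg s 4 <= p (rg s 3), rg s 7 = ncode (rev (mkseq q (rg s 6))) &
  coutput (dv s) = unary_prefix q (rg s 6) ++ nseq (rg s 5) true /\ rg s 5 <= q (rg s 6)].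

(** [Dev] steps on a constant input, but the constant is the symbol that the real run scans, so
    [dv s] remains a configuration of the run on [unary p]. *)
Lemma exec_mstep d s t : nvars <= d -> inv_p p s -> inv_m t s -> exists s',
  [/\ exec (unary p) (mstep d) s s',
      [/\ inv_p p s', inv_m t.+1 s' & out s' = out s],
      exists m, rg s' 13 = rg s 13 - m /\ rg s' 6 = rg s 6 + m,
      forall x, x \in [:: 0; 12] -> rg s' x = rg s x &
      keeps d s s'].
Proof.
move=> nd Ip [ms mpos mo mq [mout mc]].
have [//|//|s1 [x1 [dv1 ip1 out1] f1 k1]] :=
  @exec_assign M (unary p) 8 [:: 3] d _ def_id0 s _ _ nd.
have I1 : inv_p p s1 by rewrite /inv_p ip1 !f1.
have [s2 [x2 [I2 l2 dv2 out2] f2 k2]] := exec_fetch_p nd I1.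
have [//|//|s3 [x3 [dv3 ip3 out3] f3 k3]] :=
  @exec_assign M (unary p) 14 [:: 8; 1; 2; 4] d _ def_bit s2 _ _ nd.
have r14 : rg s3 14 = p (rg s 3) - rg s 4.
  have [I2' _] := I2.
  by rewrite f3//= /env_of/= I2' lookupE// !f2//= !f1.
pose s4 := setr (setr (setr s3 15 0) 16 0) 17 0.
have x4 : exec (unary p) (Seq (clear 15) (Seq (clear 16) (clear 17))) s3 s4.
  exact: ExecSeq (exec_clear _ _ _) (ExecSeq (exec_clear _ _ _) (exec_clear _ _ _)).
pose c := dv s; pose b := unary p (cpos c).
have bE : (rg s4 14 != 0) = b.
  by rewrite /b /c mpos unary_at// /s4 /= r14 -lt0n subn_gt0.
pose adv := advance (cstate c) b (scanned c); pose em := emit (cstate c) b (scanned c).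
have dv4 : dv s4 = c by rewrite /s4 /= dv3 dv2 dv1.
pose s5 := atom_step (unary p) (Dev 14 15 16 17) s4.
have x5 : exec (unary p) (Atom (Dev 14 15 16 17)) s4 s5 by exact: ExecAtom.
have f5 x : x < nvars -> rg s5 x = if x == 15 then nat_of_bool adv else
    if x == 16 then nat_of_bool (isSome em) else if x == 17 then nat_of_bool (em == Some true) else
    if x == 14 then p (rg s 3) - rg s 4 else rg s2 x.
  move=> xn; rewrite /s5 /atom_step [dev_bit _ _]bE dv4 -/adv -/em /=.
  case: (x =P 15) => [->|_]; first by case: adv.
  case: (x =P 16) => [->|_]; first by case: (isSome em).
  case: (x =P 17) => [_|_]; first by case: (em == Some true).
  by rewrite /= f3//; case: (x =P 14) => // _; rewrite -r14 f3.
have runS : run M (unary p) t.+1 = step (unary p) c by rewrite /c ms.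
have dv5 : dv s5 = run M (unary p) t.+1.
  by rewrite runS /s5 [LHS]/= [rg s4 14 != 0]bE dv4.
have ip5 : ip s5 = ip s2 by rewrite /s5 /= addn0 ip3.
have out5 : out s5 = out s by rewrite /s5 /= cats0 out3 out2 out1.
have k5 : keeps d s3 s5.
  move=> x xv xd; have nx i : i < nvars -> (x == i) = false.
    by move=> iv; rewrite gtn_eqF// (leq_trans iv).
  by rewrite /s5 /= !nx.
clearbody s5.
(* Since [M] computes [q], a symbol written now is the next one of the encoding of [q]. *)
have Iq : forall c', coutput (run M (unary p) t.+1) = coutput c ++ c' ->
  forall x, c' = [:: x] -> unary q (size (coutput c)) = x.
  move=> c' cE x c'E; rewrite -(output_nth Mpq (t := t.+1)) cE c'E.
    by rewrite nth_cat ltnn subnn.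
  by rewrite size_cat /= addn1.
have outE : coutput (run M (unary p) t.+1) = coutput c ++ seq_of_opt em.
  by rewrite runS.
have posE : cpos (run M (unary p) t.+1) = cpos c + adv.
  by rewrite runS.
have [//|//|s6 [x6 [dv6 ip6 out6] f6 k6]] :=
  @exec_assign M (unary p) 3 [:: 3; 14; 15] d _ def_index s5 _ _ nd.
have [//|//|s7 [x7 [dv7 ip7 out7] f7 k7]] :=
  @exec_assign M (unary p) 4 [:: 4; 14; 15] d _ def_offset s6 _ _ nd.
have [//|//|s8 [x8 [dv8 ip8 out8] f8 k8]] :=
  @exec_assign M (unary p) 18 [:: 16; 17] d _ def_sub01 s7 _ _ nd.
have [//|//|s9 [x9 [dv9 ip9 out9] f9 k9]] :=
  @exec_assign M (unary p) 7 [:: 7; 5; 18] d _ def_push_if s8 _ _ nd.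
have [//|//|s10 [x10 [dv10 ip10 out10] f10 k10]] :=
  @exec_assign M (unary p) 6 [:: 6; 18] d _ def_add01 s9 _ _ nd.
have [//|//|s11 [x11 [dv11 ip11 out11] f11 k11]] :=
  @exec_assign M (unary p) 5 [:: 5; 17; 18] d _ def_count s10 _ _ nd.
have [//|//|s12 [x12 [dv12 ip12 out12] f12 k12]] :=
  @exec_assign M (unary p) 13 [:: 13; 18] d _ def_sub01 s11 _ _ nd.
(* [m] is 1 if the step writes [false], which completes a number of [q], and 0 otherwise. *)
pose m : nat := isSome em - (em == Some true).
have bitE : (em == Some true) <= isSome em by case: (em) => [[]|].
have e0 x : x \in [:: 0; 1; 2; 12] -> rg s12 x = rg s2 x.
  by rewrite !inE => /or4P[] /eqP->;
     rewrite f12//= f11//= f10//= f9//= f8//= f7//= f6//= f5.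
have e3 : rg s12 3 = rg s 3 + adv * (1 - (p (rg s 3) - rg s 4)).
  rewrite f12//= f11//= f10//= f9//= f8//= f7//= f6//= /env_of/= !f5//=.
  by rewrite f2// f1.
have e4 : rg s12 4 = (rg s 4 + adv) * (1 - adv * (1 - (p (rg s 3) - rg s 4))).
  rewrite f12//= f11//= f10//= f9//= f8//= f7//= /env_of/= !f6//= !f5//=.
  by rewrite f2// f1.
have e18 : rg s8 18 = m by rewrite f8//= /env_of/= !f7//= !f6//= !f5.
have e7 : rg s12 7 = if m == 0 then rg s 7 else push (rg s 5) (rg s 7).
  rewrite f12//= f11//= f10//= f9//= /env_of/= e18 !f8//= !f7//= !f6//= !f5//=.
  by rewrite !f2// !f1.
have e6 : rg s12 6 = rg s 6 + m.
  rewrite f12//= f11//= f10//= /env_of/= !f9//= e18 !f8//= !f7//= !f6//= !f5//=.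
  by rewrite !f2// !f1.
have e5 : rg s12 5 = (rg s 5 + (em == Some true)) * (1 - m).
  rewrite f12//= f11//= /env_of/= !f10//= !f9//= e18 !f8//= !f7//= !f6//= !f5//=.
  by rewrite !f2// !f1.
have e13 : rg s12 13 = rg s 13 - m.
  rewrite f12//= /env_of/= !f11//= !f10//= !f9//= e18 !f8//= !f7//= !f6//= !f5//=.
  by rewrite !f2// !f1.
have bT : b = (rg s 4 < p (rg s 3)) by rewrite /b /c mpos unary_at.
have keep : keeps d s s12.
  apply: keeps_trans (keeps_trans k1 k2) _; apply: keeps_trans (keeps_trans k3 k5) _.
  apply: keeps_trans (keeps_trans k6 k7) _; apply: keeps_trans (keeps_trans k8 k9) _.
  exact: keeps_trans (keeps_trans k10 k11) k12.
exists s12; split=> //.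
- apply: ExecSeq x1 (ExecSeq x2 (ExecSeq x3 (ExecSeq (exec_clear _ _ _) (ExecSeq
    (exec_clear _ _ _) (ExecSeq (exec_clear _ _ _) (ExecSeq x5 (ExecSeq x6 _))))))).
  apply: ExecSeq x7 (ExecSeq x8 (ExecSeq x9 (ExecSeq x10 (ExecSeq x11 (ExecSeq x12 _))))).
  exact: ExecSkip.
- split; last by rewrite out12 out11 out10 out9 out8 out7 out6.
    by rewrite /inv_p !e0// ip12 ip11 ip10 ip9 ip8 ip7 ip6 ip5.
  have pos_ok : cpos c + adv = size (unary_prefix p (rg s12 3)) + rg s12 4 /\
      rg s12 4 <= p (rg s12 3).
    rewrite e3 e4 /c mpos; have [lt|ge] := ltnP (rg s 4) (p (rg s 3)).
      have -> : 1 - (p (rg s 3) - rg s 4) = 0.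
        by apply/eqP; rewrite subn_eq0 subn_gt0.
      rewrite !muln0 subn0 muln1 addn0 addnA; split=> //.
      by case: (adv); rewrite ?addn1// addn0.
    have pE : p (rg s 3) = rg s 4 by apply/eqP; rewrite eqn_leq mo ge.
    rewrite pE subnn subn0 !muln1; case: (adv); rewrite ?muln1 ?subnn ?muln0 ?addn0 ?pE//.
    by rewrite !addn1 unary_prefixS size_cat size_rcons size_nseq pE addnS.
  have out_ok : [/\ rg s12 7 = ncode (rev (mkseq q (rg s12 6))),
      coutput c ++ seq_of_opt em = unary_prefix q (rg s12 6) ++ nseq (rg s12 5) true &
      rg s12 5 <= q (rg s12 6)].
    rewrite e5 e6 e7 /m.
    have szE : size (coutput c) = size (unary_prefix q (rg s 6)) + rg s 5.
      by rewrite /c mout size_cat size_nseq.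
    case: (em) Iq outE => [x|] Iq outE; last by rewrite cats0 addn0 muln1 addn0.
    have xE : (rg s 5 < q (rg s 6)) = x.
      by rewrite -(unary_at mc) -szE; exact: Iq outE _ erefl.
    case: x xE {Iq outE} => xE.
      rewrite /= addn0 muln1 /c mout nseqD catA; split=> //.
      by rewrite addn1.
    have qE : q (rg s 6) = rg s 5 by apply/eqP; rewrite eqn_leq mc leqNgt xE.
    rewrite /= subn0 addn1 muln0 mq -push_mkseq qE; split=> //.
    by rewrite /c mout unary_prefixS -catA qE /= cats0 cats1.
  have dv12E : dv s12 = run M (unary p) t.+1.
    by rewrite dv12 dv11 dv10 dv9 dv8 dv7 dv6 dv5.
  case: pos_ok out_ok => [posok leok] [ok1 ok2 ok3].
  by split=> //; rewrite dv12E ?posE ?outE.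
- by exists m.
- move=> x x12'; rewrite e0; last by move: x12'; rewrite !inE => /orP[]->; rewrite ?orbT.
  by move: x12'; rewrite !inE => /orP[] /eqP->; rewrite f2// f1.
Qed.

(** Otherwise the output at time [t] would contain the terminator of number [rg s 6], but beyond the
    completed numbers it has at most [q (rg s 6)] symbols. *)
Lemma inv_m_reached t T i s : prefix (unary_prefix q i.+1) (coutput (run M (unary p) T)) ->
  inv_m t s -> T <= t -> i < rg s 6.
Proof.
move=> /size_prefix qT [ms _ _ _ [mout mc]] Tt; rewrite ltnNge; apply/negP => qi.
have := leq_trans (size_prefix (unary_prefix_le q (_ : (rg s 6).+1 <= i.+1))) qT.
have := size_prefix (coutput_mono M (unary p) T (t - T)).
rewrite subnK// -ms mout unary_prefixS !size_cat size_rcons !size_nseq => le1 /(_ qi) le2.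
have := leq_trans le2 le1.
by rewrite leq_add2l ltnNge mc.
Qed.

(** [T] is a time at which [M] has written the wanted number, so [T - t] bounds the steps still to
    be made. *)
Lemma exec_mstep_loop d T k t s : nvars <= d -> T - t <= k ->
  inv_p p s -> inv_m t s -> rg s 13 = (rg s 12).+1 - rg s 6 ->
  prefix (unary_prefix q (rg s 12).+1) (coutput (run M (unary p) T)) ->
  exists s',
    [/\ exec (unary p) (While 13 (mstep d)) s s',
        [/\ inv_p p s', exists t, inv_m t s' & out s' = out s],
        rg s' 12 < rg s' 6,
        forall x, x \in [:: 0; 12] -> rg s' x = rg s x &
        keeps d s s'].
Proof.
move=> nd; elim: k t s => [|k IH] t s tk Ip It g qT.
  rewrite leqn0 subn_eq0 in tk; have lt := inv_m_reached qT It tk.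
  exists s; split=> //; last by split=> //; exists t.
  by apply: ExecStop; apply/eqP; rewrite g subn_eq0.
have [g0|gn0] := eqVneq (rg s 13) 0.
  exists s; split=> //; [exact: ExecStop|by split=> //; exists t|].
  by rewrite -subn_eq0 -g g0.
have tT : t < T.
  rewrite ltnNge; apply/negP => /(inv_m_reached qT It) lt.
  by move/negP: gn0; apply; rewrite g subn_eq0.
have [s1 [x1 [I1 It1 out1] [m [e13 e6]] f1 k1]] := exec_mstep nd Ip It.
have [|||s' [x' [I' It' out'] l' f' k']] := IH t.+1 s1 _ I1 It1.
- by rewrite subnS; case: (T - t) tk.
- by rewrite e13 e6 f1// g subnDA.
- by rewrite f1.
exists s'; split=> //.
- exact: ExecLoop gn0 x1 x'.
- by rewrite out'.
- by move=> x xl; rewrite f'// f1.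
- exact: keeps_trans k1 k'.
Qed.

Lemma exec_fetch_q d s : nvars <= d -> inv_p p s -> (exists t, inv_m t s) -> exists s',
  [/\ exec (unary p) (fetch_q d) s s',
      [/\ inv_p p s', exists t, inv_m t s' & out s' = out s],
      rg s' 12 < rg s' 6,
      forall x, x \in [:: 0; 12] -> rg s' x = rg s x &
      keeps d s s'].
Proof.
move=> nd Ip [t It].
have [//|//|s1 [x1 [dv1 ip1 out1] f1 k1]] :=
  @exec_assign M (unary p) 13 [:: 12; 6] d _ def_guard s _ _ nd.
have I1 : inv_p p s1 by rewrite /inv_p ip1 !f1.
have It1 : inv_m t s1 by rewrite /inv_m dv1 !f1.
have g1 : rg s1 13 = (rg s1 12).+1 - rg s1 6 by rewrite !f1.
have [T qT] := Mpq (rg s1 12).+1.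
have [s' [x' [I' It' out'] l' f' k']] := exec_mstep_loop nd (leqnn (T - t)) I1 It1 g1 qT.
exists s'; split=> //.
- exact: ExecSeq x1 x'.
- by rewrite out'.
- by move=> x xl; rewrite f'//; move: xl; rewrite !inE => /orP[] /eqP->; rewrite f1.
- exact: keeps_trans k1 k'.
Qed.

Definition simulates w s := [/\ inv_p p s, exists t, inv_m t s & out s = w].

Lemma simulates_setr w s r v : nvars <= r -> simulates w s -> simulates w (setr s r v).
Proof.
move=> nr [Ip [t It] o].
have e x : x < nvars -> rg (setr s r v) x = rg s x.
  by move=> xn; rewrite /= ltn_eqF// (leq_trans xn).
by split=> //; [rewrite /inv_p !e|exists t; rewrite /inv_m !e].
Qed.

Lemma simulates_ext w s s' : dv s' = dv s -> ip s' = ip s -> out s' = out s ->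
  (forall x, x < nvars -> rg s' x = rg s x) -> simulates w s -> simulates w s'.
Proof.
move=> dvE ipE oE e [Ip [t It] o].
by split=> //; [rewrite /inv_p ipE !e|exists t; rewrite /inv_m dvE !e|rewrite oE].
Qed.

(** The count of the numbers written, and the registers of the compiled expression. *)
Definition kept r := (r == 0) || (nvars <= r).

Lemma exec_query w b d s : nvars <= d -> simulates w s -> exists s',
  [/\ exec (unary p) (query b d) s s', simulates w s',
      rg s' d = (if b then q else p) (rg s d) &
      forall r, r < d -> kept r -> rg s' r = rg s r].
Proof.
move=> nd Is; have nx i : i < nvars -> (d == i) = false.
  by move=> iv; rewrite gtn_eqF// (leq_trans iv).
case: b.
  pose s0 := setr (setr s 12 (rg s d)) d 0.
  have [Ip [t It] o] := simulates_setr 0 nd Is.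
  have I0 : inv_p p s0 by move: Ip; rewrite /inv_p /= ![_ == d]eq_sym !nx.
  have It0 : inv_m t s0 by move: It; rewrite /inv_m /= ![_ == d]eq_sym !nx.
  have [|s1 [x1 [I1 It1 out1] l1 f1 k1]] := exec_fetch_q nd I0; first by exists t.
  have [//|s2 [x2 [dv2 ip2 out2] v2 f2]] :=
    @exec_pure M (unary p) [:: 12; 6; 7] d _ def_lookup012 s1 _ nd.
  exists s2; split.
  - apply: ExecSeq (ExecSeq x1 x2); apply: exec_move_reg.
    by rewrite nx.
  - apply: simulates_ext dv2 ip2 out2 _ _; last by split=> //; rewrite out1.
    by move=> x xn; rewrite f2// (leq_trans xn).
  - rewrite v2 /env_of /=; have [t1 [_ _ _ -> _]] := It1.
    by rewrite lookupE// f1//= eq_sym nx.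
  - move=> r rd /orP[/eqP r0|nr].
      by rewrite f2// r0 f1//= eq_sym nx.
    by rewrite f2// k1//= (ltn_eqF rd) gtn_eqF// (leq_trans _ nr).
pose s0 := setr (setr s 8 (rg s d)) d 0.
have [Ip [t It] o] := simulates_setr 0 nd Is.
have I0 : inv_p p s0 by move: Ip; rewrite /inv_p /= ![_ == d]eq_sym !nx.
have It0 : inv_m t s0 by move: It; rewrite /inv_m /= ![_ == d]eq_sym !nx.
have [s1 [x1 [I1 l1 dv1 out1] f1 k1]] := exec_fetch_p nd I0.
have [//|s2 [x2 [dv2 ip2 out2] v2 f2]] :=
  @exec_pure M (unary p) [:: 8; 1; 2] d _ def_lookup012 s1 _ nd.
exists s2; split.
- apply: ExecSeq (ExecSeq x1 x2); apply: exec_move_reg.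
  by rewrite nx.
- apply: simulates_ext dv2 ip2 out2 _ _.
    by move=> x xn; rewrite f2// (leq_trans xn).
  by split=> //; [exists t; rewrite /inv_m dv1 !f1|rewrite out1].
- rewrite v2 /env_of /=; have [-> _] := I1.
  by rewrite lookupE// f1//= eq_sym nx.
- move=> r rd /orP[/eqP r0|nr].
    by rewrite f2// r0 f1//= eq_sym nx.
  by rewrite f2// k1//= (ltn_eqF rd) gtn_eqF// (leq_trans _ nr).
Qed.

End Queries.

(** * Writing the values of a functional one after the other *)

Definition driver (e : expr) : cmd := seqs [::
  compile query (regs [:: 0]) nvars e;
  While nvars (Seq (Atom (Dec nvars)) (Atom (Emit true)));
  Atom (Emit false);
  Atom (Inc 0)].

Lemma exec_emit_unary M inp r (s : store M) :
  exec inp (While r (Seq (Atom (Dec r)) (Atom (Emit true)))) s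
    (Store (rg (setr s r 0)) (dv s) (ip s) (out s ++ nseq (rg s r) true)).
Proof.
elim: {s}(rg s r) {-2}s (erefl (rg s r)) => [|n IH] s sr.
  rewrite sr cats0; have := setr_same sr; rewrite /setr => {1}<-.
  by apply: ExecStop; rewrite /= eqxx.
apply: ExecLoop; first by rewrite sr.
  exact: ExecSeq (exec_dec _ _ _) (exec_emit _ _ _).
set s' := Store _ _ _ _.
have s'r : rg s' r = n by rewrite /= eqxx sr.
have := IH _ s'r; congr (exec _ _ _ _).
rewrite s'r /= sr cat_rcons; congr Store; apply/funext => x /=.
by case: eqP.
Qed.

(** Oracle [false] is answered from the input, oracle [true] by running the embedded [M]. One
    execution of [driver] writes one number, and [loop_machine] joins the executions. *)
Lemma main_machine M f : def f -> exists M', forall p q, machine_function M p q ->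
  machine_function M' p
    (fun n => f (fun b => if b then q else p) (scons n (fun=> 0))).
Proof.
move=> df; have [M' M'P] := @loop_machine M (driver (sval df)).
exists M' => p q Mpq; set r := fun n => f _ _.
pose J i (s : store M) := simulates p q (unary_prefix r i) s /\ rg s 0 = i.
(* The invariant is a premise under the existential, so that [choice] yields a successor function on
   all stores. *)
have next (x : nat * store M) : exists s', J x.1 x.2 ->
    exec (unary p) (driver (sval df)) x.2 s' /\ J x.1.+1 s'.
  case: x => i s; have [[Is si]|nJ] := EM (J i s); last by exists s.
  have [|||//|i1|//|s1 [x1 I1 v1 f1]] := @compile_correct M (unary p) query
    (fun b => if b then q else p) (simulates p q (unary_prefix r i)) kept nvars
    _ _ _ (sval df) (regs [:: 0]) nvars s.
  - by move=> s' r' v; exact: simulates_setr.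
  - by move=> r' nr; rewrite /kept nr orbT.
  - by move=> b d s' nd I'; exact: exec_query.
  - by case: i1 => [|[]] // r' [<-].
  have {}v1 : rg s1 nvars = r i.
    rewrite v1 (svalP df) /r -si; congr (f _ _); apply/funext => -[|[|j]] //.
  have s10 : rg s1 0 = i by rewrite f1.
  pose s2 := Store (rg (setr s1 nvars 0)) (dv s1) (ip s1) (out s1 ++ nseq (rg s1 nvars) true).
  pose s3 := Store (rg s2) (dv s2) (ip s2) (rcons (out s2) false).
  exists (setr s3 0 (rg s3 0).+1) => _; split.
    apply: ExecSeq x1 (ExecSeq (exec_emit_unary _ _ _) _).
    apply: ExecSeq (exec_emit _ _ _) (ExecSeq (exec_inc _ _ _) (ExecSkip _ _)).
  have [Ip [t It] o] := I1.
  split; last by rewrite /= s10.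
  split; [by []|by exists t|].
  by rewrite /= unary_prefixS o v1 rcons_cat.
have [g gP] := choice next.
pose s := fix s n := if n is m.+1 then g (m, s m) else
  Store (fun=> 0) (initial M) 0 [::].
have Js n : J n (s n).
  elim: n => [|n IH]; last by have [] := gP (n, s n) IH.
  split=> //; split=> //; exists 0; split=> //.
move=> n; have [//|i|t tE] := M'P (unary p) s _ _ n.
  by have [] := gP (i, s i) (Js i).
exists t; rewrite tE; have [[_ _ ->] _] := Js n.
exact: prefix_refl.
Qed.

(** * Shrinking and swelling *)

Lemma of_natE n : Cantor.of_nat n = (nfst n, nsnd n).
Proof.
by rewrite -{2 3}(Cantor.cancel_to_of n); case: (Cantor.of_nat n) => i j; rewrite nfstE nsndE.
Qed.

Definition radd (x y : nat * nat) := (x.1 * y.2 + y.1 * x.2, x.2 * y.2).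
Definition rlt (x y : nat * nat) := x.1 * y.2 < y.1 * x.2.

Definition radius_pair (B : nat) := ((nfst (nsnd B)).+1, (nsnd (nsnd B)).+1).
Definition dist_code (g : baire) (l A B : nat) := g (npair (nfst A) (npair (nfst B) l)).
(** The rational approximating a distance is split into two fractions, so that inequalities can be
    tested without subtraction. *)
Definition dist_pos g l A B := (nfst (nfst (dist_code g l A B)), (nsnd (dist_code g l A B)).+1).
Definition dist_neg g l A B := (nsnd (nfst (dist_code g l A B)), (nsnd (dist_code g l A B)).+1).

(* [inside g l k A B] asserts, and [outside g l k A B] refutes, up to an error
   that vanishes with the radius of [B] and with [2^-l], that the points of the
   ball coded by [B] lie in that coded by [A] at depth [1/(k + 1)]. *)
Definition inside (g : baire) (l k A B : nat) : bool :=
  rlt (radd (radd (radd (dist_pos g l A B) (1, 2 ^ l)) (radius_pair B)) (1, k.+1))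
      (radd (radius_pair A) (dist_neg g l A B)).
Definition outside (g : baire) (l k A B : nat) : bool :=
  rlt (radd (radd (radd (dist_neg g l A B) (1, 2 ^ l)) (radius_pair B)) (radius_pair A))
      (radd (1, k.+1) (dist_pos g l A B)).

(** [visible] and [hidden] are the tests, on a whole ball [B] and at precision [l], for being
    strictly in [V j] and for not being weakly in [V i] at level [k]. Entries 0 of a name contribute
    no ball. *)
Definition visible g (V : nat -> baire) (k l j B : nat) : bool :=
  bhas k (fun m => (V j m != 0) && inside g l k (V j m).-1 B).
Definition hidden g (V : nat -> baire) (k l i B : nat) : bool :=
  ballb k (fun m => ~~ ((V i m != 0) && ~~ outside g l k (V i m).-1 B)).
Definition select g V K T i B k l : bool :=
  hidden g V k l i B && (T <= bsum K (fun j => visible g V k l j B)).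

(** * Soundness of the tests, and their success on small balls *)

Section Balls.
Local Open Scope classical_set_scope.
Local Open Scope ring_scope.
Variables (R : realType) (X : computable_metric_space R) (g : baire).
Hypothesis g_dist : forall i j k : nat,
  `|mdist (nu X i) (nu X j) - ratr (nu_rat (g (npair i (npair j k))))| <= 2^-1 ^+ k.

Definition rval (x : nat * nat) : R := x.1%:R / x.2%:R.

Lemma rval_add x y : (0 < x.2)%N -> (0 < y.2)%N -> rval (radd x y) = rval x + rval y.
Proof.
move=> x0 y0; rewrite /rval /radd /= natrD !natrM addf_div//; apply: lt0r_neq0.
  by rewrite ltr0n.
by rewrite ltr0n.
Qed.

Lemma rval_lt x y : (0 < x.2)%N -> (0 < y.2)%N -> rlt x y = (rval x < rval y).
Proof.
move=> x0 y0; rewrite /rval /rlt ltr_pdivrMr ?ltr0n// mulrAC ltr_pdivlMr ?ltr0n//.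
by rewrite -!natrM ltr_nat.
Qed.

Definition center (B : nat) : X := nu X (nfst B).
Definition radius (B : nat) : R := ratr (nu_posrat (nsnd B)).
Definition depth (k : nat) : R := k.+1%:R^-1.

Lemma alphaE B : @alpha R X B = [set x | mdist (center B) x < radius B].
Proof. by rewrite /alpha of_natE. Qed.

Lemma radiusE B : radius B = rval (radius_pair B).
Proof. rewrite /radius /nu_posrat of_natE /rval fmorph_div. by rewrite !rmorph_nat. Qed.

Lemma dist_val l A B : `|mdist (center A) (center B) -
  (rval (dist_pos g l A B) - rval (dist_neg g l A B))| <= 2^-1 ^+ l.
Proof.
rewrite /center -mulrBl.
have := g_dist (nfst A) (nfst B) l; congr (`|_ - _| <= _).
by rewrite /nu_rat !of_natE fmorph_div rmorphB !rmorph_nat.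
Qed.

Lemma rval_pow l : rval (1, 2 ^ l)%N = 2^-1 ^+ l.
Proof. by rewrite /rval /= div1r natrX exprVn. Qed.

Lemma rval_depth k : rval (1, k.+1)%N = depth k.
Proof. by rewrite /rval /= div1r. Qed.

Lemma inside_lt l k A B : inside g l k A B ->
  mdist (center A) (center B) + radius B + depth k < radius A.
Proof.
rewrite /inside rval_lt ?muln_gt0 ?expn_gt0//.
rewrite !rval_add ?muln_gt0 ?expn_gt0// -!radiusE rval_pow rval_depth.
have := dist_val l A B; rewrite ler_distl => /andP[_].
by move: (rval _) (rval _) => a b h1 h2; lra.
Qed.

(** The slack is [2^-1 ^+ l] twice: for the error of the approximate distance, and for the margin
    built into the test. *)
Lemma lt_inside l k A B :
  mdist (center A) (center B) + radius B + depth k + 2 * 2^-1 ^+ l < radius A ->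
  inside g l k A B.
Proof.
rewrite /inside rval_lt ?muln_gt0 ?expn_gt0//.
rewrite !rval_add ?muln_gt0 ?expn_gt0// -!radiusE rval_pow rval_depth.
have := dist_val l A B; rewrite ler_distl => /andP[+ _].
by move: (rval _) (rval _) => a b h1 h2; lra.
Qed.

Lemma outside_lt l k A B : outside g l k A B ->
  radius A + radius B < mdist (center A) (center B) + depth k.
Proof.
rewrite /outside rval_lt ?muln_gt0 ?expn_gt0//.
rewrite !rval_add ?muln_gt0 ?expn_gt0// -!radiusE rval_pow rval_depth.
have := dist_val l A B; rewrite ler_distl => /andP[+ _].
by move: (rval _) (rval _) => a b h1 h2; lra.
Qed.

Lemma lt_outside l k A B :
  radius A + radius B + 2 * 2^-1 ^+ l < mdist (center A) (center B) + depth k ->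
  outside g l k A B.
Proof.
rewrite /outside rval_lt ?muln_gt0 ?expn_gt0//.
rewrite !rval_add ?muln_gt0 ?expn_gt0// -!radiusE rval_pow rval_depth.
have := dist_val l A B; rewrite ler_distl => /andP[_].
by move: (rval _) (rval _) => a b h1 h2; lra.
Qed.

(** Truth for all small enough balls around [x] and good enough precisions. Finitely many such tests
    succeed on a common ball, by taking the minimum of their bounds. *)
Definition robust (x : X) (S : nat -> nat -> Prop) : Prop :=
  exists2 eps : R, 0 < eps & forall B l, mdist (center B) x < radius B ->
    radius B < eps -> 2^-1 ^+ l < eps -> S B l.

(** With [1/(m + 1)] below the bound, density gives a centre within this radius of [x], and [m.+1]
    serves as precision because [2 ^ m.+1] exceeds [m.+1]. *)
Lemma robust_witness x S : robust x S -> exists B l, @alpha R X B x /\ S B l.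
Proof.
case=> e e0 eS.
have [m] := ltr_add_invr e0; rewrite add0r => em.
pose r : R := m.+1%:R^-1.
have r0 : 0 < r by rewrite invr_gt0.
have [||y [/interior_subset + [a _ ay]]] := @nu_dense _ X (interior (ball x r)).
- by exists x; exact: (nbhsx_ballx x r).
- exact: open_interior.
rewrite ballEmdist /= metric_sym -ay => ax.
have [l le] : exists l : nat, 2^-1 ^+ l < e.
  exists m.+1; apply: le_lt_trans em; rewrite exprVn lef_pV2 ?posrE ?exprn_gt0//.
  by rewrite -natrX ler_nat ltnW// ltn_expl.
pose B := npair a (npair 0 m).
have rE : radius B = r.
  rewrite /radius /B nsndE /nu_posrat /npair Cantor.cancel_of_to mul1r fmorphV.
  by rewrite -[RHS]/(m.+1%:R^-1) -[in RHS](ratr_nat R).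
have cE : center B = nu X a by rewrite /center nfstE.
exists B, l; rewrite alphaE /= rE cE; split=> //.
by apply: eS; rewrite ?rE ?cE.
Qed.

Lemma robust_imp x S S' : (forall B l, S B l -> S' B l) -> robust x S -> robust x S'.
Proof. by move=> SS' [e e0 eS]; exists e => // B l *; apply/SS'/eS. Qed.

Lemma robust_and x S S' : robust x S -> robust x S' -> robust x (fun B l => S B l /\ S' B l).
Proof.
move=> [e e0 eS] [e' e'0 eS']; exists (Num.min e e'); first by rewrite lt_min e0.
by move=> B l Bx; rewrite !lt_min => /andP[? ?] /andP[? ?]; split; [exact: eS|exact: eS'].
Qed.

Lemma robust_all x n (S : nat -> nat -> nat -> Prop) :
  (forall m, (m < n)%N -> robust x (S m)) ->
  robust x (fun B l => forall m, (m < n)%N -> S m B l).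
Proof.
elim: n => [_|n IH rS]; first by exists 1.
have := robust_and (IH (fun m mn => rS m (ltnW mn))) (rS n (ltnSn n)).
apply: robust_imp => B l [Sm Sn] m; rewrite ltnS leq_eqVlt => /predU1P[->//|].
exact: Sm.
Qed.

Lemma robust_inside x k A : mdist (center A) x + depth k < radius A ->
  robust x (fun B l => inside g l k A B).
Proof.
(* One quarter of the slack each for the radius of [B] and for the distance of its centre from [x];
   [lt_inside] takes the other two. *)
move=> h; exists ((radius A - (mdist (center A) x + depth k)) / 4).
  by rewrite divr_gt0// subr_gt0.
move=> B l Bx rB lB; apply: lt_inside.
have := metric_triangle (center A) x (center B).
by rewrite (metric_sym x); lra.
Qed.

Lemma robust_outside x k A : radius A < mdist (center A) x + depth k ->
  robust x (fun B l => outside g l k A B).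
Proof.
move=> h; exists ((mdist (center A) x + depth k - radius A) / 4).
  by rewrite divr_gt0// subr_gt0.
move=> B l Bx rB lB; apply: lt_outside.
have := metric_triangle (center A) (center B) x.
by lra.
Qed.

(** * The sets of selected points *)

Section Families.
Variables (V : nat -> baire) (K : nat).

Definition strictly_in (k j : nat) (x : X) : bool := bhas k (fun m =>
  (V j m != 0%N) && (mdist (center (V j m).-1) x + depth k < radius (V j m).-1)).
Definition weakly_in (k j : nat) (x : X) : bool := bhas k (fun m =>
  (V j m != 0%N) && (mdist (center (V j m).-1) x + depth k <= radius (V j m).-1)).

(** The set [E_T,i] of the outline. Both conditions refer to the same level, which is what bounds
    the order in [selected_card]. *)
Definition selected (T i : nat) (x : X) : Prop :=
  exists k, ~~ weakly_in k i x && (T <= bsum K (fun j => strictly_in k j x))%N.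

Lemma bhasP n (P : nat -> bool) : reflect (exists2 m, (m < n)%N & P m) (bhas n P).
Proof.
apply: (iffP hasP) => -[m mn Pm]; exists m => //; first by rewrite mem_iota in mn.
by rewrite mem_iota.
Qed.

Lemma ballbP n (P : nat -> bool) : reflect (forall m, (m < n)%N -> P m) (ballb n P).
Proof.
by apply: (iffP allP) => PP m mn; apply: PP; move: mn; rewrite mem_iota.
Qed.

Lemma leq_bsum n (f h : nat -> nat) : (forall i, (i < n)%N -> (f i <= h i)%N) ->
  (bsum n f <= bsum n h)%N.
Proof. by move=> fh; apply: leq_sum => i _; exact: fh. Qed.

Lemma depth_gt0 k : 0 < depth k. Proof. by rewrite invr_gt0. Qed.

Lemma depth_anti k k' : (k <= k')%N -> depth k' <= depth k.
Proof. by move=> kk'; rewrite lef_pV2 ?posrE// ler_nat ltnS. Qed.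

Lemma weakly_in_mono k k' j x : (k <= k')%N -> weakly_in k j x -> weakly_in k' j x.
Proof.
move=> kk' /bhasP[m mk /andP[V0 h]]; apply/bhasP; exists m; first exact: leq_trans kk'.
by rewrite V0 (le_trans _ h)// lerD2l depth_anti.
Qed.

Lemma strictly_in_mono k k' j x : (k <= k')%N -> strictly_in k j x -> strictly_in k' j x.
Proof.
move=> kk' /bhasP[m mk /andP[V0 h]]; apply/bhasP; exists m; first exact: leq_trans kk'.
by rewrite V0 (le_lt_trans _ h)// lerD2l depth_anti.
Qed.

Lemma strictly_weakly k j x : strictly_in k j x -> weakly_in k j x.
Proof. by move=> /bhasP[m mk /andP[V0 /ltW h]]; apply/bhasP; exists m => //; rewrite V0. Qed.

Lemma enumeratedP p x : @enumerated R X p x <->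
  exists m, (p m != 0%N) && (mdist (center (p m).-1) x < radius (p m).-1).
Proof.
split=> [[m /= pm]|[m /andP[pm h]]]; last by exists m; rewrite /= ?alphaE// lt0n.
by rewrite alphaE /= => h; exists m; rewrite h -lt0n pm.
Qed.

Lemma weakly_in_enumerated k j x : weakly_in k j x -> enumerated (V j) x.
Proof.
move=> /bhasP[m _ /andP[V0 h]]; apply/enumeratedP; exists m; rewrite V0.
by apply: lt_le_trans h; rewrite ltrDl depth_gt0.
Qed.

Lemma enumerated_strictly_in j x : enumerated (V j) x -> exists k, strictly_in k j x.
Proof.
move=> /enumeratedP[m /andP[V0 h]].
have [n] := ltr_add_invr h => hn; exists (maxn m.+1 n); apply/bhasP; exists m.
  by rewrite leq_maxl.
rewrite V0; apply: le_lt_trans hn; rewrite lerD2l; apply: depth_anti.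
exact: leq_maxr.
Qed.

(** The radius of [B], included in the tests, absorbs the distance from [x] to the centre of [B] in
    the triangle inequality. *)
Lemma select_selected T i B k l x : @alpha R X B x -> select g V K T i B k l ->
  selected T i x.
Proof.
rewrite alphaE /= => Bx /andP[/ballbP hid vis]; exists k; apply/andP; split.
  apply/negP => /bhasP[m mk /andP[V0]]; move: (hid m mk); rewrite V0 negbK.
  move=> /outside_lt h h'.
  have := metric_triangle (center (V i m).-1) x (center B).
  by rewrite (metric_sym x); lra.
apply: leq_trans vis _; apply: leq_bsum => j _.
case vis: (visible _ _ _ _ _ _) => //=.
suff -> : strictly_in k j x by [].
have /bhasP[m mk /andP[V0 /inside_lt h]] := vis; apply/bhasP; exists m => //.
rewrite V0; have := metric_triangle (center (V j m).-1) (center B) x.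
by lra.
Qed.

(** At a fixed level the conditions amount to finitely many strict inequalities, each of which is
    detected on small balls around [x]. *)
Lemma robust_select T i x : selected T i x ->
  exists k, robust x (fun B l => select g V K T i B k l).
Proof.
case=> k /andP[hid vis]; exists k.
have rh : robust x (fun B l => hidden g V k l i B).
  apply: (@robust_imp _ (fun B l => forall m, (m < k)%N ->
     V i m != 0%N -> outside g l k (V i m).-1 B)).
    move=> B l h; apply/ballbP => m mk; apply/negP => /andP[V0] /negP; apply; exact: h.
  apply: robust_all => m mk; case V0 : (V i m != 0%N); last by exists 1.
  have : radius (V i m).-1 < mdist (center (V i m).-1) x + depth k.
    rewrite ltNge; apply/negP => h; move/negP: hid; apply; apply/bhasP; exists m => //.
    by rewrite V0.
  by move=> /robust_outside; apply: robust_imp.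
have rv : robust x (fun B l => forall j, (j < K)%N -> strictly_in k j x ->
    visible g V k l j B).
  apply: robust_all => j _; case Pj : (strictly_in k j x); last by exists 1.
  have /bhasP[m mk /andP[V0 /robust_inside]] := Pj.
  by apply: robust_imp => B l ins _; apply/bhasP; exists m => //; rewrite V0.
apply: robust_imp (robust_and rh rv) => B l [h v]; rewrite /select h /=.
apply: leq_trans vis _; apply: leq_bsum => j jK.
by case Pj : (strictly_in k j x) => //; rewrite v.
Qed.

Lemma bsumE (P : nat -> bool) : bsum K P = #|[set i : 'I_K | P i]%SET|.
Proof. by rewrite /bsum -sum1dep_card [RHS]big_mkcond; apply: eq_bigr => i _; case: (P i). Qed.

(* At the least of the levels at which the members of [S] are selected, all of
   them are hidden. *)
Lemma selected_card (S : {set 'I_K}) T x : S != finset.set0 ->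
  (forall i, i \in S -> selected T i x) -> (#|S| + T <= K)%N.
Proof.
move=> /set0Pn[i0 i0S] sel.
have ex : exists k, [exists i in S,
    ~~ weakly_in k i x && (T <= bsum K (fun j => strictly_in k j x))%N].
  by have [k kP] := sel _ i0S; exists k; apply/existsP; exists i0; rewrite i0S.
have [k /existsP[i /and3P[iS _ vis]] kmin] := ex_minnP ex.
apply: leq_trans (leq_add (leqnn _) vis) _; rewrite bsumE.
(* [S] and the set of indices that are strict at the least level [k] are disjoint, so together they
   have at most [K] elements. *)
rewrite -[leqRHS]card_ord -cardsUI.
have -> : (S :&: [set i : 'I_K | strictly_in k i x]%SET = finset.set0)%SET.
  apply/setP => j; rewrite !inE; apply/negP => /andP[jS /strictly_weakly].
  have [k' k'P] := sel _ jS.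
  have kk' : (k <= k')%N by apply: kmin; apply/existsP; exists j; rewrite jS.
  by move=> /(weakly_in_mono kk'); apply/negP; case/andP: k'P.
by rewrite cards0 addn0 max_card.
Qed.

(** A point outside [V i] is weakly in it at no level. So any level at which all members of [S] have
    become strict will do, for instance the maximum of their levels. *)
Lemma selected_of_card (S : {set 'I_K}) T i x : ~ enumerated (V i) x ->
  (forall j, j \in S -> enumerated (V j) x) -> (T <= #|S|)%N -> selected T i x.
Proof.
move=> Vi VS TS.
have /choice[f fP] : forall j : 'I_K, exists k, j \in S -> strictly_in k j x.
  move=> j; case: (boolP (j \in S)) => [/VS/enumerated_strictly_in[k kP]|]; last by exists 0%N.
  by exists k.
exists (\max_j f j)%N; apply/andP; split; first by apply/negP => /weakly_in_enumerated.
apply: leq_trans TS _; rewrite bsumE; apply/subset_leq_card/fintype.subsetP => j jS.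
by rewrite inE (strictly_in_mono _ (fP _ jS))// leq_bigmax.
Qed.

End Families.
End Balls.

(** * Reductions *)

(* A functional has two oracles, the input and the output of one machine, hence
   two stages: [p] and the output [q] for [f] are first packed into a single
   sequence, from which [post] is then computed with the help of [g]. *)
Lemma computable_reduction (X Y X' Y' : Type) (dX : representation X)
    (dY : representation Y) (dX' : representation X') (dY' : representation Y')
    (f : multifun X Y) (f' : multifun X' Y') (g : baire)
    (pre : baire -> baire) (post : baire -> baire -> baire -> baire) :
  computable_seq g ->
  def (fun O e => pre (O false) (e 0)) ->
  def (fun O e => post (fun i => nfst (O false i)) (fun i => nsnd (O false i)) (O true) (e 0)) ->
  (forall p x', names dX' p x' -> mdom f' x' ->
    exists x, [/\ names dX (pre p) x, mdom f x &
      forall q y, names dY q y -> mval f x y ->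
      exists y', names dY' (post p q g) y' /\ mval f' x' y']) ->
  computable_multifun dX dY f -> computable_multifun dX' dY' f'.
Proof.
move=> [Mg Mgg] dpre dpost red [F [M FM] Ff].
(* [Mg] writes [g] on every input, so it can be the embedded machine of the first and the last
   stage. *)
have Mg_g p : machine_function Mg p g by rewrite -Mgg.
have [Mpre Mpre_ok] := main_machine Mg dpre.
(* Here the embedded machine is [Mpre] followed by [M]: oracle [true] is [q], and the input [p] is
   still available as oracle [false]. *)
have [Mpair Mpair_ok] := main_machine (xmachine Mpre M)
  (def_pair (def_orc false (def_var 0)) (def_orc true (def_var 0))).
have [Mpost Mpost_ok] := main_machine Mg dpost.
exists (machine_function (xmachine Mpair Mpost)); first by exists (xmachine Mpair Mpost).
move=> p x' px' dx'; have [x [prex dx fx]] := red _ _ px' dx'.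
have [q [y [Fq qy xy]]] := Ff _ _ prex dx.
have [y' [sy' xy']] := fx _ _ qy xy.
exists (post p q g), y'; split=> //.
have M1 := xmachine_correct (Mpre_ok _ _ (Mg_g p)) ((FM _ _).1 Fq).
have M2 := Mpost_ok _ _ (Mg_g (fun n => npair (p n) (q n))).
move: (xmachine_correct (Mpair_ok _ _ M1) M2) => /=.
have -> : (fun i => nfst (npair (p i) (q i))) = p.
  by apply/funext => i; rewrite nfstE.
have -> : (fun i => nsnd (npair (p i) (q i))) = q.
  by apply/funext => i; rewrite nsndE.
by [].
Qed.

(** The half of [n] is found by a sum, which keeps the definition within the reach of [def_tac]. *)
Definition interleave (a b : baire) : baire :=
  fun n => bsum n.+1 (fun i => if i.*2 == n then a i else if i.*2.+1 == n then b i else 0).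

Lemma even_interleave a b : even_part (interleave a b) = a.
Proof.
apply/funext => i; rewrite /even_part /interleave (@bsum_only _ _ i) ?eqxx//.
  by rewrite ltnS -addnn leq_addr.
move=> k /negPf ki; case: (k.*2.+1 =P i.*2) => [/(congr1 odd)|_].
  by rewrite /= !odd_double.
by rewrite -!muln2 eqn_mul2r /= ki.
Qed.

Lemma odd_interleave a b : odd_part (interleave a b) = b.
Proof.
apply/funext => i; rewrite /odd_part /interleave (@bsum_only _ _ i) ?eqxx//.
- by case: eqP => // /(congr1 odd); rewrite /= !odd_double.
- by rewrite ltnS -addnn leqW// leq_addr.
move=> k /negPf ki; case: (k.*2 =P i.*2.+1) => [/(congr1 odd)|_]; first by rewrite /= !odd_double.
by rewrite eqSS -!muln2 eqn_mul2r /= ki.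
Qed.

Local Open Scope classical_set_scope.

(** * Covers, order, and unions over fibres *)

Section SetFamilies.
Variable T : Type.
Implicit Types (A B : nat -> set T) (D J : set nat).

Definition fiber_union J A (r : nat -> nat) : nat -> set T :=
  fun i => [set x | exists j, [/\ J j, r j = i & A j x]].

(** A point common to the unions with distinct indices [i a] lies in sets [A (j a)] with
    [r (j a) = i a], so the [j a] are distinct too. *)
Lemma order_fiber_union J D A r n : order_le J A n -> order_le D (fiber_union J A r) n.
Proof.
move=> oA i i_inj Di; apply/seteqP; split=> // x xi.
have /choice[j jP] : forall a, exists j, [/\ J j, r j = i a & A j x].
  by move=> a; exact: xi.
have j_inj : injective j.
  move=> a b jab; apply: i_inj.
  by have [_ <- _] := jP a; have [_ <- _] := jP b; rewrite jab.
have Jj a : J (j a) by have [] := jP a.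
rewrite -(oA j j_inj Jj) => a _; by have [] := jP a.
Qed.

Lemma order_le_sub D A B n : (forall i, D i -> B i `<=` A i) ->
  order_le D A n -> order_le D B n.
Proof.
move=> BA oA i i_inj Di; apply/seteqP; split=> // x xi.
by rewrite -(oA i i_inj Di) => a _; apply: BA (Di a) _ _; exact: xi.
Qed.

Lemma is_cover_sub D A B : (forall i, D i -> A i `<=` B i) -> is_cover D A -> is_cover D B.
Proof.
move=> AB cA; apply/seteqP; split=> // x _.
have : (\bigcup_(i in D) A i) x by rewrite cA.
by move=> [i Di Ax]; exists i => //; exact: AB.
Qed.

Lemma cover_mem D A x : is_cover D A -> exists2 i, D i & A i x.
Proof. by move=> cA; have : (\bigcup_(i in D) A i) x by rewrite cA. Qed.

Lemma mem_cover D A : (forall x, exists2 i, D i & A i x) -> is_cover D A.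
Proof. by move=> h; apply/seteqP; split=> // x _; exact: h. Qed.

Lemma fiber_union_shrinking J D A B r : is_cover J A ->
  (forall j, J j -> D (r j) /\ A j `<=` B (r j)) -> shrinking D (fiber_union J A r) B.
Proof.
move=> cA JD; split; last first.
  by move=> i _ x [j [/JD[_ AB] <-]]; exact: AB.
apply: mem_cover => x; have [j Jj Ax] := cover_mem x cA.
by exists (r j); [have [] := JD _ Jj|exists j].
Qed.

End SetFamilies.

(** * Names of families of sets, and operations on them *)

Section Names.
Variables (R : realType) (X : computable_metric_space R).

(** Every sequence names an open set and a closed set. Hence the output of a reduction always names
    a family, and only its members remain to be determined. *)
Lemma omega_names_total Y (delta : representation Y) : (forall p, exists x, names delta p x) ->
  forall p, exists x, names (delta_omega delta) p x.
Proof.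
by move=> /choice[f fP] p; exists (fun i => f (component p i)) => i; exact: fP.
Qed.

Lemma star_names_total Y (delta : representation Y) : (forall p, exists x, names delta p x) ->
  forall p, exists x, names (delta_star delta) p x.
Proof.
move=> /choice[f fP] p; exists (mkseq (fun i => f (component (tail p) i)) (p 0)).
split=> [|i]; first by rewrite size_mkseq.
have ip : i < p 0 by apply: leq_trans (ltn_ord i) _; rewrite size_mkseq.
by rewrite (tnth_nth (f p)) /= nth_mkseq.
Qed.

Lemma star_Sigma01P p (U : seq (Sigma01 X)) : names (delta_star (delta_Sigma01 X)) p U ->
  p 0 = size U /\ forall i, i < size U -> opens U i = @enumerated R X (component (tail p) i).
Proof.
move=> [p0 pU]; split=> // i iU; have x0 : Sigma01 X by case: (U) iU.
have := pU (Ordinal iU); rewrite /= /Sigma01_names (tnth_nth x0) /= => <-.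
by rewrite /opens (nth_map x0).
Qed.

Lemma star_Pi01P p (F : seq (Pi01 X)) : names (delta_star (delta_Pi01 X)) p F ->
  p 0 = size F /\ forall i, i < size F -> closeds F i = ~` @enumerated R X (component (tail p) i).
Proof.
move=> [p0 pF]; split=> // i iF; have x0 : Pi01 X by case: (F) iF.
have := pF (Ordinal iF); rewrite /= /Pi01_names (tnth_nth x0) /= => <-.
by rewrite /closeds (nth_map x0).
Qed.

Lemma enumerated_mem p (x : X) :
  @enumerated R X p x <-> exists2 i, p i != 0 & @alpha R X (p i).-1 x.
Proof. by split=> -[i pi ix]; exists i => //; move: pi; rewrite /= -lt0n. Qed.

End Names.

(** Entry [<i,<j,k>>] is entry [k] of the name of [W_j] if [r_j = i], and otherwise 0, which adds no
    ball. *)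
Definition merge_omega (q : baire) : baire := fun n =>
  if q (nfst (nsnd n)).*2.+1 == nfst n then q (npair (nfst (nsnd n)) (nsnd (nsnd n))).*2
  else 0.

(** As [merge_omega], with the length in front: [q 0] is the length of the word of sets and [q 1]
    the code of the word of indices. *)
Definition merge_star (p q : baire) : baire := fun n =>
  if n == 0 then p 0 else
  if ((nfst (nsnd n.-1)).+1 <= q 0) && (nnth (q 1) (nfst (nsnd n.-1)) == nfst n.-1)
  then q (npair (nfst (nsnd n.-1)) (nsnd (nsnd n.-1))).+1.*2 else 0.

Definition pad (p : baire) : baire := fun n => if nfst n < p 0 then p n.+1 else 0.

Definition shift_name (p q : baire) : baire := fun n => if n == 0 then p 0 else q n.-1.

(** After the length, entry [<i,<B,<k,l>>>] puts the ball [B] into the complement of [F_i] if [B]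
    passes the test for [E_1,i] at level [k] and precision [l]. *)
Definition closed_shrinking_name (p q g : baire) : baire := fun n =>
  if n == 0 then p 0 else
  if select g (fun j m => q (npair j m).+1) (p 0) 1 (nfst n.-1)
       (nfst (nsnd n.-1)) (nfst (nsnd (nsnd n.-1))) (nsnd (nsnd (nsnd n.-1)))
  then (nfst (nsnd n.-1)).+1 else 0.

(* [n.-1] encodes the index of the set, the ball [B], the level and precision
   [k] and [l] of the selection, and a ball of the given open set together with
   the level at which it contains [B]. *)
Definition swelling_name (N : nat) (p q g : baire) : baire := fun n =>
  if n == 0 then q 0 else
  if select g (fun j m => q (npair j m).+1.*2) (q 0) (q 0 - N.+1) (nfst n.-1)
       (nfst (nsnd n.-1)) (nfst (nsnd (nsnd n.-1))) (nfst (nsnd (nsnd (nsnd n.-1)))) &&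
     ((p (npair (nnth (q 1) (nfst n.-1)) (nfst (nsnd (nsnd (nsnd (nsnd n.-1)))))).+1 != 0) &&
      inside g (nfst (nsnd (nsnd (nsnd n.-1)))) (nsnd (nsnd (nsnd (nsnd (nsnd n.-1)))))
        (p (npair (nnth (q 1) (nfst n.-1)) (nfst (nsnd (nsnd (nsnd (nsnd n.-1)))))).+1).-1
        (nfst (nsnd n.-1)))
  then (nfst (nsnd n.-1)).+1 else 0.

Lemma def_closed_shrinking_name : def (fun O e => closed_shrinking_name
  (fun i => nfst (O false i)) (fun i => nsnd (O false i)) (O true) (e 0)).
Proof.
rewrite /closed_shrinking_name /select /hidden /visible /inside /outside /rlt /radd
  /dist_pos /dist_neg /radius_pair /dist_code.
cbn [fst snd].
def_tac.
Qed.

Lemma def_swelling_name N : def (fun O e => interleave (swelling_name N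
  (fun i => nfst (O false i)) (fun i => nsnd (O false i)) (O true))
  (fun _ => nsnd (O false 1)) (e 0)).
Proof.
rewrite /interleave /swelling_name /select /hidden /visible /inside /outside /rlt /radd
  /dist_pos /dist_neg /radius_pair /dist_code.
cbn [fst snd].
def_tac.
Qed.

(** * The implications between the conditions *)

Section Implications.
Variables (R : realType) (X : computable_metric_space R) (N : nat).
Let Sigma := delta_Sigma01 X.
Let Pi := delta_Pi01 X.
Let nu_comp := cid2 (nu_computable X).
Let g := s2val nu_comp.
Let g_comp : computable_seq g := s2valP nu_comp.
Let g_dist := s2valP' nu_comp.

Lemma omega_to_dot :
  computable_multifun (delta_omega Sigma) (delta_omega Sigma) (C_omega X N) ->
  computable_multifun (delta_omega Sigma) (delta_prod (delta_omega Sigma) delta_id)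
    (Cdot_omega X N).
Proof.
apply: (@computable_reduction _ _ _ _ _ _ _ _ _ _ g (fun p => p)
  (fun p q g => interleave q (fun i => i)) g_comp).
- def_tac.
- rewrite /interleave; def_tac.
move=> p U pU cU; exists U; split=> // q W qW [[cW WU] oW].
exists (W, fun i => i); split; last by split=> // j; exact: WU.
by split; rewrite /= ?even_interleave ?odd_interleave.
Qed.

Lemma dot_to_omega :
  computable_multifun (delta_omega Sigma) (delta_prod (delta_omega Sigma) delta_id)
    (Cdot_omega X N) ->
  computable_multifun (delta_omega Sigma) (delta_omega Sigma) (C_omega X N).
Proof.
apply: (@computable_reduction _ _ _ _ _ _ _ _ _ _ g (fun p => p)
  (fun p q g => merge_omega q) g_comp).
- def_tac.
- rewrite /merge_omega; def_tac.
move=> p U pU cU; exists U; split=> // q [W r] [/= qW qr] [WU cW oW].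
have [W' W'P] := omega_names_total (delta := Sigma) (@Sigma01_names_total R X) (merge_omega q).
exists W'; split=> //; have {}qr : odd_part q = r := qr.
have W'E i : open_set (W' i) = fiber_union setT W r i.
  rewrite (W'P i); apply/seteqP; split=> [x /enumerated_mem[m]|x [j [_ ji Wx]]].
    rewrite /component /merge_omega nfstE nsndE; case: ifP => // /eqP ri m0 mx.
    exists (nfst m); split=> //; first by rewrite -qr.
    by rewrite (qW (nfst m)); apply/enumerated_mem; exists (nsnd m).
  move: Wx; rewrite (qW j) => /enumerated_mem[m m0 mx].
  apply/enumerated_mem; exists (npair j m);
  by rewrite /component /merge_omega nfstE nsndE nfstE nsndE -[q j.*2.+1]/(odd_part q j) qr ji
    eqxx.
have -> : (fun i => W' i : set X) = fiber_union setT W r by apply/funext => i; rewrite W'E.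
split; last exact: order_fiber_union oW.
by apply: fiber_union_shrinking => // j _; split=> //; exact: WU.
Qed.

Lemma omega_to_star :
  computable_multifun (delta_omega Sigma) (delta_omega Sigma) (C_omega X N) ->
  computable_multifun (delta_star Sigma) (delta_star Sigma) (C_star X N).
Proof.
apply: (@computable_reduction _ _ _ _ _ _ _ _ _ _ g pad
  (fun p q g => shift_name p q) g_comp).
- rewrite /pad; def_tac.
- rewrite /shift_name; def_tac.
move=> p U /star_Sigma01P[p0 pU] cU.
have [U' U'P] := omega_names_total (delta := Sigma) (@Sigma01_names_total R X) (pad p).
have U'E i : open_set (U' i) = if i < size U then opens U i else set0.
  rewrite (U'P i); case: ifPn => iU; last first.
    apply/seteqP; split=> // x /enumerated_mem[m].
    by rewrite /component /pad nfstE p0 (negPf iU).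
  rewrite pU//; congr enumerated; apply/funext => m.
  by rewrite /component /pad nfstE p0 iU.
exists U'; split=> //.
  apply: mem_cover => x; have [i /= iU Ux] := cover_mem x cU.
  by exists i => //; rewrite U'E iU.
move=> q W qW [[cW WU] oW].
have [W' W'P] := star_names_total (delta := Sigma) (@Sigma01_names_total R X) (shift_name p q).
exists W'; split=> //.
have [sW W'E] := star_Sigma01P W'P.
have {}sW : size W' = size U by rewrite -sW /shift_name.
have {}W'E i : i < size U -> opens W' i = W i.
  by move=> iU; rewrite W'E ?sW// (qW i).
split=> //; last first.
  apply: (@order_le_sub _ _ W) => [i /= iU|]; first by rewrite W'E.
  by move=> i i_inj _; exact: oW.
split=> [|i /= iU]; last first.
  by rewrite W'E//; apply: subset_trans (WU i I) _; rewrite U'E iU.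
apply: mem_cover => x; have [i _ Wx] := cover_mem x cW.
(* Beyond [size U] the padded cover is empty, hence so is [W i], and cutting these sets off loses no
   point. *)
have := WU i I x Wx; rewrite U'E; case: ifPn => // iU _.
by exists i => //; rewrite W'E.
Qed.

Lemma star_to_dot :
  computable_multifun (delta_star Sigma) (delta_star Sigma) (C_star X N) ->
  computable_multifun (delta_star Sigma) (delta_prod (delta_star Sigma) delta_word)
    (Cdot_star X N).
Proof.
apply: (@computable_reduction _ _ _ _ _ _ _ _ _ _ g (fun p => p)
  (fun p q g => interleave q (fun i => nword_iota (p 0))) g_comp).
- def_tac.
- rewrite /interleave; def_tac.
move=> p U pU cU; exists U; split=> // q W qW [sW [cW WU] oW].
have [p0 _] := star_Sigma01P pU.
exists (W, iota 0 (size U)); split.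
  split; rewrite /= ?even_interleave ?odd_interleave//.
  by rewrite /word_names nword_iotaE p0.
rewrite -sW in cW WU oW; split=> //; first by rewrite size_iota sW.
by move=> j jW; rewrite nth_iota -?sW// add0n; split=> //; exact: WU.
Qed.

Lemma bar_to_dot :
  computable_multifun (delta_star Sigma) (delta_star Pi) (Cbar X N) ->
  computable_multifun (delta_star Sigma) (delta_prod (delta_star Pi) delta_word)
    (Cbardot X N).
Proof.
apply: (@computable_reduction _ _ _ _ _ _ _ _ _ _ g (fun p => p)
  (fun p q g => interleave q (fun i => nword_iota (p 0))) g_comp).
- def_tac.
- rewrite /interleave; def_tac.
move=> p U pU cU; exists U; split=> // q F qF [sF [cF FU] oF].
have [p0 _] := star_Sigma01P pU.
exists (F, iota 0 (size U)); split.
  split; rewrite /= ?even_interleave ?odd_interleave//.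
  by rewrite /word_names nword_iotaE p0.
rewrite -sF in cF FU oF; split=> //; first by rewrite size_iota sF.
by move=> j jF; rewrite nth_iota -?sF// add0n; split=> //; exact: FU.
Qed.

Lemma dot_to_star :
  computable_multifun (delta_star Sigma) (delta_prod (delta_star Sigma) delta_word)
    (Cdot_star X N) ->
  computable_multifun (delta_star Sigma) (delta_star Sigma) (C_star X N).
Proof.
apply: (@computable_reduction _ _ _ _ _ _ _ _ _ _ g (fun p => p)
  (fun p q g => merge_star p q) g_comp).
- def_tac.
- rewrite /merge_star; def_tac.
move=> p U pU cU; exists U; split=> // q [W w] [/= /star_Sigma01P[q0 qW] q1] [sw WU cW oW].
have [p0 _] := star_Sigma01P pU.
have [W' W'P] := star_names_total (delta := Sigma) (@Sigma01_names_total R X) (merge_star p q).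
exists W'; split=> //.
have [sW' W'E] := star_Sigma01P W'P.
have {}sW' : size W' = size U by rewrite -sW' -p0.
have {}W'E i : i < size U -> opens W' i = fiber_union `I_(size W) (opens W) (nth 0 w) i.
  move=> iU; rewrite W'E ?sW'//.
  have qw j : j < size W -> nnth (q 1) j = nth 0 w j.
    by move=> jW; rewrite -[q 1]/(odd_part q 0) q1 nnthE// sw.
  apply/seteqP; split=> [x /enumerated_mem[m]|x [j [/= jW ji Wx]]].
    rewrite /component /tail /merge_star /= nfstE nsndE -[q 0]/(even_part q 0) q0.
    case: ifPn => // /andP[jW /eqP ri] m0 mx; rewrite qw// in ri.
    exists (nfst m); split=> //.
    by rewrite qW//; apply/enumerated_mem; exists (nsnd m).
  move: Wx; rewrite qW// => /enumerated_mem[m m0 mx].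
  apply/enumerated_mem; exists (npair j m);
  by rewrite /component /tail /merge_star /= nfstE nsndE nfstE nsndE -[q 0]/(even_part q 0) q0 jW
    qw// ji eqxx.
have [cM MU] : shrinking `I_(size U) (fiber_union `I_(size W) (opens W) (nth 0 w)) (opens U).
  exact: fiber_union_shrinking cW WU.
split=> //; last first.
  have oM := @order_fiber_union _ _ `I_(size U) _ (nth 0 w) _ oW.
  by apply: order_le_sub oM => i /= iU; rewrite W'E.
split=> [|i /= iU]; last by rewrite W'E//; exact: MU.
by apply: is_cover_sub cM => i /= iU; rewrite W'E.
Qed.

(** A point outside [W_i] lies in some [W_j], so it is selected for [i] with threshold 1; thus [F_i]
    lies in [W_i] and the order is inherited. By [selected_card] no point is selected for all
    indices, so the [F_i] cover. *)
Lemma star_to_bar :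
  computable_multifun (delta_star Sigma) (delta_star Sigma) (C_star X N) ->
  computable_multifun (delta_star Sigma) (delta_star Pi) (Cbar X N).
Proof.
apply: (@computable_reduction _ _ _ _ _ _ _ _ _ _ g (fun p => p)
  closed_shrinking_name g_comp).
- def_tac.
- exact: def_closed_shrinking_name.
move=> p U pU cU; exists U; split=> // q W /star_Sigma01P[q0 qW] [sW [cW WU] oW].
have [p0 _] := star_Sigma01P pU.
have [F FP] := star_names_total (delta := Pi) (@Pi01_names_total R X)
  (closed_shrinking_name p q g).
exists F; split=> //.
have [sF FE] := star_Pi01P FP.
have {}sF : size F = size U by rewrite -sF.
pose V := component (tail q).
have {}FE i : i < size U -> closeds F i = ~` [set x | selected V (size U) 1 i x].
  move=> iU; rewrite FE ?sF//; congr (~` _); apply/seteqP; split=> x.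
    move=> /enumerated_mem[m].
    rewrite /component /tail /closed_shrinking_name /= nfstE nsndE p0.
    by case: ifPn => // sel _ /= mx; apply: (select_selected g_dist mx sel).
  move=> /(robust_select g_dist)[k /(robust_witness)[B [l [xB sel]]]].
  have {}sel : select g (fun j m => q (npair j m).+1) (size U) 1 i B k l := sel.
  apply/enumerated_mem; exists (npair B (npair k l));
  by rewrite /component /tail /closed_shrinking_name /= !(nfstE, nsndE) p0 sel.
have VE i x : i < size U -> opens W i x -> enumerated (V i) x.
  by move=> iU; rewrite qW// sW.
have EV i x : i < size U -> enumerated (V i) x -> opens W i x.
  by move=> iU; rewrite qW// sW.
have FW i : i < size U -> closeds F i `<=` opens W i.
  move=> iU x; rewrite FE// => nsel; apply: contrapT => nW; apply: nsel.
  have [j /= jU Wj] := cover_mem x cW.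
  apply: (@selected_of_card _ _ _ _ [set Ordinal jU]%SET); last by rewrite cards1.
    by move=> /(EV _ _ iU).
  by move=> j'; rewrite inE => /eqP ->; exact: VE.
split=> //; last exact: order_le_sub oW.
split=> [|i iU x /(FW _ iU)]; last exact: WU.
apply: mem_cover => x.
apply: contrapT => nF.
have sel i : i < size U -> selected V (size U) 1 i x.
  move=> iU; apply: contrapT => nsel; apply: nF; exists i => //.
  by rewrite FE.
(* [selected_card] needs a nonempty set of indices; an index exists because [x] is covered. *)
have [j /= jU _] := cover_mem x cW.
have := @selected_card _ _ V (size U) [set: 'I_(size U)]%SET 1 x.
rewrite cardsT card_ord addn1 ltnn => /(_ _ (fun i _ => sel i (ltn_ord i))).
suff : [set: 'I_(size U)]%SET != finset.set0 by move=> h /(_ h).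
by apply/set0Pn; exists (Ordinal jU); rewrite inE.
Qed.

(** A point of [F_i] is in at most [N + 1] of the closed sets, hence in enough of their complements
    to be selected for [i]. Conversely, [selected_card] does not allow selection for [N + 2]
    indices. *)
Lemma bardot_to_dot :
  computable_multifun (delta_star Sigma) (delta_prod (delta_star Pi) delta_word)
    (Cbardot X N) ->
  computable_multifun (delta_star Sigma) (delta_prod (delta_star Sigma) delta_word)
    (Cdot_star X N).
Proof.
apply: (@computable_reduction _ _ _ _ _ _ _ _ _ _ g (fun p => p)
  (fun p q g => interleave (swelling_name N p q g) (fun _ => q 1)) g_comp).
- def_tac.
- exact: def_swelling_name.
move=> p U pU cU; exists U; split=> // q [F w] [/= /star_Pi01P[q0 qF] q1] [sw FU cF oF].
have [p0 {}pU] := star_Sigma01P pU.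
have [W WP] := star_names_total (delta := Sigma) (@Sigma01_names_total R X)
  (swelling_name N p q g).
exists (W, w); split; first by split; rewrite /= ?even_interleave ?odd_interleave.
have {}q0 : q 0 = size F by [].
have {}q1 : q 1 = ncode w by [].
have [sW WE] := star_Sigma01P WP.
have {}sW : size W = size F by rewrite -sW /swelling_name.
pose V := component (tail (even_part q)).
have {}WE i : i < size F ->
    opens W i = opens U (nth 0 w i) `&` [set x | selected V (size F) (size F - N.+1) i x].
  move=> iF; have [iU _] := FU i iF.
  have wi : nnth (q 1) i = nth 0 w i by rewrite q1 nnthE// sw.
  rewrite WE ?sW// pU//; apply/seteqP; split=> x.
    move=> /enumerated_mem[m].
    rewrite /component /tail /swelling_name [(_.+1 == 0)]/= [_.+1.-1]/= nfstE nsndE q0 wi.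
    case: ifPn => // /andP[sel /andP[u0 ins]] _ mx; split; last first.
      exact: (select_selected g_dist mx sel).
    apply/enumeratedP; exists (nfst (nsnd (nsnd (nsnd m)))); rewrite u0 /=.
    have := inside_lt g_dist ins; move: mx; rewrite alphaE /= => mx.
    have := metric_triangle (center X (p (npair (nth 0 w i) (nfst (nsnd (nsnd (nsnd m))))).+1).-1)
      (center X (nfst m)) x.
    have := depth_gt0 R (nsnd (nsnd (nsnd (nsnd m)))).
    by rewrite /component /tail; move: (mdist _ _) (mdist _ _) (mdist _ _) mx => a b c; lra.
  move=> [/enumeratedP[m /andP[u0 mx]] /(robust_select g_dist)[k rsel]].
  (* The strict inequality leaves room for a depth [1/(k' + 1)], so membership in the given open set
     becomes a robust test. *)
  have [k' hk'] := ltr_add_invr mx.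
  have /(robust_inside g_dist) rin := hk'.
  have [B [l [xB [sel ins]]]] := robust_witness (robust_and rsel rin).
  have {}sel : select g (fun j m => q (npair j m).+1.*2) (size F) (size F - N.+1) i B k l := sel.
  apply/enumerated_mem; exists (npair B (npair k (npair l (npair m k'))));
  by rewrite /component /tail /swelling_name [(_.+1 == 0)]/= [_.+1.-1]/= !(nfstE, nsndE) q0 wi
    sel u0 ins.
have VE i x : i < size F -> ~ closeds F i x -> enumerated (V i) x.
  by move=> iF nF; apply: contrapT => nV; apply: nF; rewrite qF.
have EV i x : i < size F -> closeds F i x -> ~ enumerated (V i) x.
  by move=> iF; rewrite qF.
split; first by rewrite sw sW.
- move=> j; rewrite sW => jF; have [? _] := FU j jF; split=> //.
  by rewrite WE//; exact: subIsetl.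
- rewrite sW; apply: is_cover_sub cF => i /= iF x Fx.
  rewrite WE//; split; first by have [_] := FU i iF; exact.
  pose S := [set j : 'I_(size F) | `[< closeds F j x >]]%SET.
  apply: (@selected_of_card _ _ _ _ (~: S)%SET); first exact: EV.
    by move=> j; rewrite !inE => /asboolP; exact: VE.
  rewrite cardsCs finset.setCK card_ord leq_sub2l// leqNgt; apply/negP => NS.
  (* Enumerating [S] yields [N + 2] distinct closed sets through [x], contrary to their order. *)
  have [e e_inj eS] : exists2 e : 'I_N.+2 -> 'I_(size F), injective e & forall a, e a \in S.
    exists (fun a => enum_val (widen_ord NS a)); last by move=> a; exact: enum_valP.
    by move=> a b /enum_val_inj /(congr1 val) /= /val_inj.
  have := oF (fun a => e a) (fun a b ab => e_inj _ _ (val_inj ab)) (fun a => ltn_ord (e a)).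
  move/seteqP => [+ _] => /(_ x); apply=> a _.
  by have := eS a; rewrite inE => /asboolP.
- rewrite sW => i i_inj iF; apply/seteqP; split=> // x xi.
  pose e a : 'I_(size F) := Ordinal (iF a).
  have e_inj : injective e by move=> a b /(congr1 val); exact: i_inj.
  pose S := [set e a | a in 'I_N.+2]%SET.
  have SN : #|S| = N.+2 by rewrite card_imset// card_ord.
  have := @selected_card _ _ V (size F) S (size F - N.+1) x.
  rewrite SN => h; suff : N.+2 + (size F - N.+1) <= size F.
    (* A contradiction also when the subtraction in the threshold is truncated to 0. *)
    by rewrite addSn -ltn_subRL ltnn.
  apply: h.
    by rewrite -card_gt0 SN.
  move=> _ /imsetP[a _ ->].
  by have := xi a I; rewrite WE; [case|exact: iF].
Qed.

End Implications.

Theorem lemma6p2 (R : realType) (X : computable_metric_space R) (N : nat) :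
  let Sigma := delta_Sigma01 X in
  let Pi := delta_Pi01 X in
  let c1 := computable_multifun (delta_omega Sigma) (delta_omega Sigma)
    (C_omega X N) in
  let c2 := computable_multifun (delta_omega Sigma)
    (delta_prod (delta_omega Sigma) delta_id) (Cdot_omega X N) in
  let c3 := computable_multifun (delta_star Sigma) (delta_star Sigma)
    (C_star X N) in
  let c4 := computable_multifun (delta_star Sigma)
    (delta_prod (delta_star Sigma) delta_word) (Cdot_star X N) in
  let c5 := computable_multifun (delta_star Sigma) (delta_star Pi)
    (Cbar X N) in
  let c6 := computable_multifun (delta_star Sigma)
    (delta_prod (delta_star Pi) delta_word) (Cbardot X N) in
  [/\ c3 <-> c4, c4 <-> c5 & c5 <-> c6] /\ (c1 <-> c2) /\ (c2 -> c3).
Proof.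
split; last by split; [split; [exact: omega_to_dot|exact: dot_to_omega]|
  move=> /dot_to_omega; exact: omega_to_star].
split; split.
- exact: star_to_dot.
- exact: dot_to_star.
- by move=> /dot_to_star; exact: star_to_bar.
- by move=> /bar_to_dot; exact: bardot_to_dot.
- exact: bar_to_dot.
- by move=> /bardot_to_dot /dot_to_star; exact: star_to_bar.
Qed.
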